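(* Let $\Bbbk$ be an algebraically closed field of characteristic zero, and let $G=\langle(1\ 2)(3\ 4),(1\ 3)(2\ 4)\rangle$ be the Klein four subgroup of $\mathcal S_4$ acting on $A=V_4$ by permutations of the generators. Then $\mathsf p(A,G)=4$.
   Context: $V_4$ is the $\Bbbk$-algebra generated by $x_1,\dots,x_4$ with relations $x_ix_j+x_jx_i=0$ for $i\neq j$; a permutation $\sigma$ acts by the algebra automorphism with $\sigma(x_i)=x_{\sigma(i)}$. The skew group algebra $A\#G$ is $A\otimes \Bbbk G$ as a vector space with multiplication $(a\# g)(b\# h)=a\,g(b)\# gh$. With $f_G=\sum_{g\in G}1\#g$ and $(f_G)$ the two-sided ideal of $A\#G$ it generates, the pertinency is $\mathsf p(A,G)=\operatorname{GKdim}A-\operatorname{GKdim}\,(A\#G)/(f_G)$, where $\operatorname{GKdim}$ is Gelfand-Kirillov dimension. *)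

(* Defs.v *)
From HB Require Import structures.
From mathcomp Require Import all_boot all_order all_algebra all_fingroup.
From mathcomp Require Import generic_quotient ring_quotient.
From mathcomp.multinomials Require Import monalg.
From mathcomp Require Import all_classical all_reals all_analysis.

Set Implicit Arguments.
Unset Strict Implicit.
Unset Printing Implicit Defensive.

Import Order.TTheory GRing.Theory Num.Theory.
Local Open Scope classical_set_scope.
Local Open Scope ring_scope.
Local Open Scope quotient_scope.

(* Seals products and projections whose unfolding makes unification diverge. *)
Fact seal_key : unit. Proof. exact: tt. Qed.

Section TwoSidedIdeals.
Variables (k : fieldType) (B : algType k).

Definition two_sided_ideal (I : set B) : Prop :=
  [/\ I 0, (forall x y, I x -> I y -> I (x - y)),
      (forall a x, I x -> I (a * x)) & (forall a x, I x -> I (x * a))].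

Definition ideal_gen (S : set B) : set B := smallest two_sided_ideal S.

Lemma ideal_gen_ideal S : two_sided_ideal (ideal_gen S).
Proof.
split=> [J [[] //]|x y Ix Iy J JP|a x Ix J JP|a x Ix J JP].
- by case: (JP) => -[_ JB _ _] _; apply: JB; [apply: Ix|apply: Iy].
- by case: (JP) => -[_ _ JM _] _; apply: JM; apply: Ix.
- by case: (JP) => -[_ _ _ JM] _; apply: JM; apply: Ix.
Qed.

Lemma sub_ideal_gen S : S `<=` ideal_gen S.
Proof. by move=> x Sx J [_]; apply. Qed.

Lemma ideal_gen_min S I : two_sided_ideal I -> S `<=` I -> ideal_gen S `<=` I.
Proof. by move=> IP SI x; apply. Qed.

(* Properness is required because MathComp's algType excludes the zero ring. *)
Record proper_ideal := ProperTwoSidedIdeal {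
  pideal : set B;
  pidealP : two_sided_ideal pideal;
  pideal_proper : ~ pideal 1
}.

Definition proper_ideal_gen (S : set B) (S1 : ~ ideal_gen S 1) : proper_ideal :=
  ProperTwoSidedIdeal (ideal_gen_ideal S) S1.

Definition in_pideal (I : proper_ideal) : {pred B} :=
  fun x => `[< pideal I x >].

Lemma in_pideal_zmod_closed I : zmod_closed (in_pideal I).
Proof.
case: (pidealP I) => I0 IB _ _; split; first exact/asboolP.
by move=> x y /asboolP Ix /asboolP Iy; apply/asboolP/IB.
Qed.

HB.instance Definition _ I :=
  GRing.isZmodClosed.Build B (in_pideal I) (in_pideal_zmod_closed I).

End TwoSidedIdeals.

Section QuotientAlgebra.
Variables (k : fieldType) (B : algType k) (I : proper_ideal B).

Definition alg_quot : Type := Quotient.quot (in_pideal I).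
HB.instance Definition _ := EqQuotient.on alg_quot.
HB.instance Definition _ := Choice.on alg_quot.
HB.instance Definition _ := GRing.Zmodule.on alg_quot.

Definition to_quot : B -> alg_quot :=
  locked_with seal_key (fun x => \pi_alg_quot x).

Lemma to_quotE x : to_quot x = \pi_alg_quot x.
Proof. by rewrite /to_quot unlock. Qed.

Lemma to_quotP x y : to_quot x = to_quot y <-> pideal I (x - y).
Proof.
rewrite !to_quotE; split=> [/eqP|Ixy].
  by rewrite -[_ == _](Quotient.idealrBE (in_pideal I)) => /asboolP.
by apply/eqP; rewrite -[_ == _](Quotient.idealrBE (in_pideal I)); apply/asboolP.
Qed.

Lemma to_quotK (q : alg_quot) : to_quot (repr q) = q.
Proof. by rewrite to_quotE reprK. Qed.

Lemma to_quot_repr (x : B) : pideal I (repr (to_quot x) - x).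
Proof. by apply/to_quotP; rewrite to_quotK. Qed.

Lemma to_quotD : {morph to_quot : x y / x + y}.
Proof.
by move=> x y; rewrite !to_quotE; apply: (@Quotient.pi_add B (in_pideal I)).
Qed.

Definition quot_one : alg_quot := to_quot 1.
Definition quot_mul (p q : alg_quot) : alg_quot := to_quot (repr p * repr q).
Definition quot_scale (c : k) (p : alg_quot) : alg_quot :=
  to_quot (c *: repr p).

Lemma to_quotM x y : to_quot (x * y) = quot_mul (to_quot x) (to_quot y).
Proof.
case: (pidealP I) => _ IB IM IMr; apply/to_quotP.
have -> : x * y - repr (to_quot x) * repr (to_quot y)
    = - (repr (to_quot x) - x) * repr (to_quot y)
      - x * (repr (to_quot y) - y).
  by rewrite mulNr mulrBl mulrBr !opprB [RHS]addrC addrA subrK.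
have I0 : pideal I 0 by case: (pidealP I).
apply: (IB); last exact/IM/to_quot_repr.
by apply: IMr; rewrite -sub0r; apply: IB => //; apply: to_quot_repr.
Qed.

Lemma to_quotZ c x : to_quot (c *: x) = quot_scale c (to_quot x).
Proof.
case: (pidealP I) => I0 IB IM _; apply/to_quotP.
rewrite -[X in pideal I X]opprB -scalerBr -sub0r; apply: (IB) => //.
by rewrite -[X in c *: X]mul1r scalerAl; apply/IM/to_quot_repr.
Qed.

Lemma quot_mulA : associative quot_mul.
Proof.
move=> p q r; rewrite -(to_quotK p) -(to_quotK q) -(to_quotK r).
by rewrite -!to_quotM mulrA.
Qed.

Lemma quot_mul1l : left_id quot_one quot_mul.
Proof. by move=> p; rewrite -(to_quotK p) -to_quotM mul1r. Qed.

Lemma quot_mul1r : right_id quot_one quot_mul.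
Proof. by move=> p; rewrite -(to_quotK p) -to_quotM mulr1. Qed.

Lemma quot_mulDl : left_distributive quot_mul +%R.
Proof.
move=> p q r; rewrite -(to_quotK p) -(to_quotK q) -(to_quotK r).
by rewrite -to_quotD -!to_quotM -to_quotD mulrDl.
Qed.

Lemma quot_mulDr : right_distributive quot_mul +%R.
Proof.
move=> p q r; rewrite -(to_quotK p) -(to_quotK q) -(to_quotK r).
by rewrite -to_quotD -!to_quotM -to_quotD mulrDr.
Qed.

Lemma quot_one_neq0 : quot_one != 0.
Proof.
apply/eqP; have -> : 0 = to_quot 0.
  by apply: (@addIr _ (to_quot 0)); rewrite -to_quotD !add0r.
by move/to_quotP; rewrite subr0; apply: pideal_proper.
Qed.

HB.instance Definition _ := GRing.Zmodule_isNzRing.Build alg_quot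
  quot_mulA quot_mul1l quot_mul1r quot_mulDl quot_mulDr quot_one_neq0.

Lemma quot_scaleA c d p : quot_scale c (quot_scale d p) = quot_scale (c * d) p.
Proof. by rewrite -(to_quotK p) -!to_quotZ scalerA. Qed.

Lemma quot_scale1 : left_id 1 quot_scale.
Proof. by move=> p; rewrite -(to_quotK p) -to_quotZ scale1r. Qed.

Lemma quot_scaleDr : right_distributive quot_scale +%R.
Proof.
move=> c p q; rewrite -(to_quotK p) -(to_quotK q).
by rewrite -to_quotD -!to_quotZ -to_quotD scalerDr.
Qed.

Lemma quot_scaleDl p : {morph quot_scale^~ p : c d / c + d}.
Proof. by move=> c d; rewrite -(to_quotK p) -!to_quotZ -to_quotD scalerDl. Qed.

HB.instance Definition _ := GRing.Zmodule_isLmodule.Build k alg_quot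
  quot_scaleA quot_scale1 quot_scaleDr quot_scaleDl.

Lemma quot_scaleAl (c : k) (p q : alg_quot) : c *: (p * q) = (c *: p) * q.
Proof.
rewrite -(to_quotK p) -(to_quotK q) -[_ * _]to_quotM -[c *: _]to_quotZ.
by rewrite -[c *: _]to_quotZ -[RHS]to_quotM scalerAl.
Qed.

HB.instance Definition _ := GRing.Lmodule_isLalgebra.Build k alg_quot
  quot_scaleAl.

Lemma quot_scaleAr (c : k) (p q : alg_quot) : c *: (p * q) = p * (c *: q).
Proof.
rewrite -(to_quotK p) -(to_quotK q) -[_ * _]to_quotM -[c *: _]to_quotZ.
by rewrite -[c *: _]to_quotZ -[RHS]to_quotM scalerAr.
Qed.

HB.instance Definition _ := GRing.Lalgebra_isAlgebra.Build k alg_quot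
  quot_scaleAr.

Lemma to_quot_is_linear : linear to_quot.
Proof. by move=> c x y; rewrite to_quotD to_quotZ. Qed.
HB.instance Definition _ := GRing.isLinear.Build k B alg_quot _ to_quot
  to_quot_is_linear.

Lemma to_quot_is_monoid_morphism : monoid_morphism to_quot.
Proof. by split=> // x y; rewrite to_quotM. Qed.
HB.instance Definition _ := GRing.isMonoidMorphism.Build B alg_quot to_quot
  to_quot_is_monoid_morphism.

End QuotientAlgebra.

Section FreeAlgebra.
Variables (k : fieldType) (n : nat).

Definition free_alg : Type := {malg k[{fmonom 'I_n}]}.
HB.instance Definition _ := GRing.Lmodule.on free_alg.

Definition free_mul : free_alg -> free_alg -> free_alg :=
  locked_with seal_key (fun p q => (p : {malg k[{fmonom 'I_n}]}) * q).

Lemma free_mulE p q : free_mul p q = (p : {malg k[{fmonom 'I_n}]}) * q.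
Proof. by rewrite /free_mul unlock. Qed.

Lemma free_mulA : associative free_mul.
Proof. by move=> p q r; rewrite !free_mulE mulrA. Qed.

Lemma free_mul1l : left_id (1 : {malg k[{fmonom 'I_n}]}) free_mul.
Proof. by move=> p; rewrite free_mulE mul1r. Qed.

Lemma free_mul1r : right_id (1 : {malg k[{fmonom 'I_n}]}) free_mul.
Proof. by move=> p; rewrite free_mulE mulr1. Qed.

Lemma free_mulDl : left_distributive free_mul +%R.
Proof. by move=> p q r; rewrite !free_mulE mulrDl. Qed.

Lemma free_mulDr : right_distributive free_mul +%R.
Proof. by move=> p q r; rewrite !free_mulE mulrDr. Qed.

HB.instance Definition _ := GRing.Zmodule_isNzRing.Build free_alg
  free_mulA free_mul1l free_mul1r free_mulDl free_mulDr
  (oner_neq0 {malg k[{fmonom 'I_n}]}).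

Lemma free_algM (p q : free_alg) : p * q = free_mul p q.
Proof. by []. Qed.

Lemma free_scaleAl (c : k) (p q : free_alg) :
  c *: (p * q) = (c *: p : free_alg) * q.
Proof.
by rewrite !free_algM !free_mulE; apply: fgscaleAl.
Qed.
HB.instance Definition _ := GRing.Lmodule_isLalgebra.Build k free_alg
  free_scaleAl.

Lemma free_scaleAr (c : k) (p q : free_alg) :
  c *: (p * q) = p * (c *: q : free_alg).
Proof.
rewrite !free_algM !free_mulE.
have mulC (r : {malg k[{fmonom 'I_n}]}) : r * c%:MP = c%:MP * r.
  rewrite !malgM_def fgmulUg fgmulgU; apply: eq_bigr => i _.
  by rewrite mulm1 mul1m mulrC.
by rewrite -[LHS]mul_malgC mulrA -mulC -mulrA (mul_malgC c q).
Qed.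
HB.instance Definition _ := GRing.Lalgebra_isAlgebra.Build k free_alg
  free_scaleAr.

Definition free_gen (i : 'I_n) : free_alg := << fmu i >>.

Section Lift.
Variables (B : algType k) (x : 'I_n -> B).

Definition mono_eval (m : {fmonom 'I_n}) : B := \prod_(i <- (m : seq 'I_n)) x i.

Definition free_lift : free_alg -> B := mmap (in_alg B) mono_eval.

Lemma mono_eval_mmorphism : mmorphism mono_eval.
Proof.
by split=> [m m'|]; rewrite /mono_eval ?fmM ?fm1 ?big_cat ?big_nil.
Qed.
HB.instance Definition _ := isMultiplicative.Build {fmonom 'I_n} B
  mono_eval mono_eval_mmorphism.

Lemma free_lift_is_linear : linear free_lift.
Proof.
move=> c p q; rewrite /free_lift mmapD mmapZ /=.
by rewrite -scalerAl mul1r.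
Qed.
HB.instance Definition _ := GRing.isLinear.Build k free_alg B _ free_lift
  free_lift_is_linear.

Lemma free_lift_is_monoid_morphism : monoid_morphism free_lift.
Proof.
have comm_f (p : {malg k[{fmonom 'I_n}]}) m m' :
    GRing.comm (in_alg B p@_m) (mono_eval m').
  by rewrite /GRing.comm -scalerAl -scalerAr mul1r mulr1.
have [fM f1] := commr_mmap_is_multiplicative comm_f.
by split=> // p q; rewrite free_algM free_mulE; apply: fM.
Qed.
HB.instance Definition _ := GRing.isMonoidMorphism.Build free_alg B free_lift
  free_lift_is_monoid_morphism.

Lemma free_liftD : {morph free_lift : p q / p + q}.
Proof. exact: raddfD. Qed.

Lemma free_liftM : {morph free_lift : p q / p * q}.
Proof. exact: rmorphM. Qed.

Lemma free_lift_gen i : free_lift (free_gen i) = x i.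
Proof.
rewrite /free_lift mmapU /mono_eval fmU big_seq1.
by rewrite -[RHS]mul1r; congr (_ * _); apply: scale1r.
Qed.

Lemma free_lift_uniq (f : {lrmorphism free_alg -> B}) :
  (forall i, f (free_gen i) = x i) -> f =1 free_lift.
Proof.
move=> fx p; rewrite [p]monalgE [LHS]linear_sum [RHS]linear_sum.
apply: eq_bigr => m _.
have -> : << p@_m *g m >> =
    p@_m *: \prod_(i <- (m : seq 'I_n)) free_gen i :> free_alg.
  apply/malgP => m'; rewrite mcoeffZ.
  have -> : \prod_(i <- (m : seq 'I_n)) free_gen i = << m >> :> free_alg.
    case: m => s; elim: s => [|i s IHs].
      by rewrite big_nil -fmoneE.
    rewrite big_cons [in LHS]IHs free_algM free_mulE malgM_def.
    rewrite fgmulUU mulr1.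
    by congr mkmalgU; apply: val_inj; rewrite /= fmM fmU.
  by rewrite [in LHS]mcoeffU [in RHS]mcoeffU mulr_natr.
rewrite [LHS]linearZ [RHS]linearZ !rmorph_prod; congr (_ *: _).
apply: eq_bigr => i _; exact: etrans (fx i) (esym (free_lift_gen i)).
Qed.

End Lift.
End FreeAlgebra.

Section SkewPolynomials.
Variables (k : fieldType) (n : nat).

Definition skew_rels : set (free_alg k n) :=
  [set r | exists i j : 'I_n, i != j /\
     r = free_gen k i * free_gen k j + free_gen k j * free_gen k i].

Lemma skew_rels_lift (B : algType k) (x : 'I_n -> B) :
  (forall i j, i != j -> x i * x j + x j * x i = 0) ->
  forall p, ideal_gen skew_rels p -> free_lift x p = 0.
Proof.
move=> xP p; apply: (ideal_gen_min (I := [set p | free_lift x p = 0])).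
  split=> /= [|a b fa fb|a b fb|a b fb].
  - exact: linear0.
  - by rewrite linearB /= fa fb subrr.
  - by rewrite rmorphM /= fb mulr0.
  - by rewrite rmorphM /= fb mul0r.
move=> _ [i [j [ij ->]]] /=.
by rewrite free_liftD !free_liftM !free_lift_gen xP.
Qed.

Lemma skew_rels_proper : ~ ideal_gen skew_rels 1.
Proof.
have /skew_rels_lift rel0 :
    forall i j : 'I_n, i != j -> (0 : k^o) * 0 + 0 * 0 = 0.
  by move=> *; rewrite mulr0 addr0.
by move/rel0/eqP; rewrite rmorph1 oner_eq0.
Qed.

(* V_n *)
Definition skew_alg : Type := alg_quot (proper_ideal_gen skew_rels_proper).
HB.instance Definition _ := GRing.Algebra.on skew_alg.

Definition skew_gen (i : 'I_n) : skew_alg :=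
  to_quot (proper_ideal_gen skew_rels_proper) (free_gen k i).

Lemma skew_genP i j :
  i != j -> skew_gen i * skew_gen j + skew_gen j * skew_gen i = 0.
Proof.
move=> ij; rewrite /skew_gen -!rmorphM -rmorphD -(rmorph0 (to_quot _)).
by apply/to_quotP; rewrite subr0; apply: sub_ideal_gen; exists i, j.
Qed.

Section Lift.
Variables (B : algType k) (x : 'I_n -> B).
Hypothesis xP : forall i j, i != j -> x i * x j + x j * x i = 0.

Lemma skew_lift_to_quot p :
  free_lift x (repr (to_quot (proper_ideal_gen skew_rels_proper) p)) =
  free_lift x p.
Proof.
apply/eqP; rewrite -subr_eq0 -linearB; apply/eqP/(skew_rels_lift xP).
exact: (@to_quot_repr _ _ (proper_ideal_gen skew_rels_proper) p).
Qed.
End Lift.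

Section Permutation.
Variable s : 'S_n.

(* The algebra endomorphism of V_n with x_i |-> x_(s i); see perm_map_gen. *)
Definition perm_map (p : skew_alg) : skew_alg :=
  free_lift (fun i => skew_gen (s i)) (repr p).

Lemma perm_rels i j : i != j ->
  skew_gen (s i) * skew_gen (s j) + skew_gen (s j) * skew_gen (s i) = 0.
Proof. by move=> ij; rewrite skew_genP // (inj_eq perm_inj). Qed.

Lemma perm_map_to_quot p :
  perm_map (to_quot _ p) = free_lift (fun i => skew_gen (s i)) p.
Proof. exact: skew_lift_to_quot perm_rels p. Qed.

Lemma perm_map_is_linear : linear perm_map.
Proof.
move=> c p q.
transitivity (perm_map (to_quot _ (c *: (repr p : free_alg k n) + repr q))).
  by congr perm_map; rewrite to_quot_is_linear !to_quotK.
by rewrite perm_map_to_quot free_lift_is_linear.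
Qed.
HB.instance Definition _ := GRing.isLinear.Build k skew_alg skew_alg _ perm_map
  perm_map_is_linear.

Lemma perm_map_is_monoid_morphism : monoid_morphism perm_map.
Proof.
split=> [|p q]; first by rewrite perm_map_to_quot rmorph1.
rewrite -(to_quotK p) -(to_quotK q) -rmorphM.
by rewrite !perm_map_to_quot rmorphM.
Qed.
HB.instance Definition _ := GRing.isMonoidMorphism.Build skew_alg skew_alg
  perm_map perm_map_is_monoid_morphism.

Lemma perm_map_gen i : perm_map (skew_gen i) = skew_gen (s i).
Proof. by rewrite perm_map_to_quot free_lift_gen. Qed.

End Permutation.

Lemma skew_alg_ext (B : algType k) (f g : {lrmorphism skew_alg -> B}) :
  (forall i, f (skew_gen i) = g (skew_gen i)) -> f =1 g.
Proof.
move=> fg p; rewrite -(to_quotK p).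
pose pi := to_quot (proper_ideal_gen skew_rels_proper).
have := @free_lift_uniq k n B (f \o skew_gen) (f \o pi) (fun=> erefl) (repr p).
have := @free_lift_uniq k n B (f \o skew_gen) (g \o pi)
  (fun i => esym (fg i)) (repr p).
by move=> /= -> ->.
Qed.

Lemma perm_map1 : perm_map 1 =1 id.
Proof.
apply: (@skew_alg_ext _ (perm_map 1) idfun) => i /=.
by rewrite perm_map_gen perm1.
Qed.

Lemma perm_mapM (s t : 'S_n) p :
  perm_map (s * t)%g p = perm_map t (perm_map s p).
Proof.
pose f : {lrmorphism skew_alg -> skew_alg} := perm_map t \o perm_map s.
apply: (@skew_alg_ext _ (perm_map (s * t)%g) f) => i /=.
by rewrite !perm_map_gen permM.
Qed.

End SkewPolynomials.

(* The product s * t of MathComp permutations is "s, then t", so alg_actM is the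
   axiom of a left action for the composition product of permutations. *)
Record alg_action (k : fieldType) (gT : finGroupType) (A : algType k) :=
  AlgAction {
    alg_act :> gT -> {lrmorphism A -> A};
    alg_act1 : alg_act 1%g =1 id;
    alg_actM : forall g h a, alg_act (g * h)%g a = alg_act h (alg_act g a)
  }.

Definition perm_alg_action (k : fieldType) (n : nat) :
    alg_action 'S_n (skew_alg k n) :=
  AlgAction (alg_act := fun s => perm_map s) (@perm_map1 k n) (@perm_mapM k n).

(* A # G: an element u stands for \sum_g (u g # g). The action is a parameter
   because the product depends on it. *)
Definition skew_group_alg (k : fieldType) (gT : finGroupType) (A : algType k)
  (to : alg_action gT A) (G : {group gT}) : Type := {ffun subg_of G -> A}.

Section SkewGroupAlgebra.
Variables (k : fieldType) (gT : finGroupType) (A : algType k).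
Variables (to : alg_action gT A) (G : {group gT}).

Local Notation sga := (skew_group_alg to G).

HB.instance Definition _ := GRing.Lmodule.copy sga {ffun subg_of G -> A}.

Definition smash (a : A) (g : subg_of G) : sga :=
  [ffun h => if h == g then a else 0].

Definition sga_one : sga := smash 1 1%g.

(* (a # g) (b # h) = a g(b) # gh, where the composite gh is the MathComp product
   h * g; see smashM. *)
Definition sga_mul (u v : sga) : sga :=
  [ffun z => \sum_g \sum_(h | (h * g)%g == z) u g * to (sgval g) (v h)].

Lemma sga_mulE u v z :
  sga_mul u v z = \sum_g u g * to (sgval g) (v (z * g^-1)%g).
Proof.
rewrite ffunE; apply: eq_bigr => g _; rewrite (big_pred1 (z * g^-1)%g) // => h.
by apply/eqP/eqP => [<-|->]; rewrite ?mulgK ?mulgKV.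
Qed.

Lemma sga_mulA : associative sga_mul.
Proof.
move=> u v w; apply/ffunP => z; rewrite !sga_mulE.
have -> : \sum_g sga_mul u v g * to (sgval g) (w (z * g^-1)%g) =
    \sum_g \sum_h u h * to (sgval h) (v (g * h^-1)%g)
                       * to (sgval g) (w (z * g^-1)%g).
  by apply: eq_bigr => g _; rewrite sga_mulE mulr_suml.
rewrite [RHS]exchange_big /=; apply: eq_bigr => h _.
rewrite sga_mulE raddf_sum mulr_sumr [RHS](reindex_inj (mulIg h)) /=.
apply: eq_bigr => g _.
by rewrite rmorphM mulgK alg_actM invMg !mulgA !mulrA.
Qed.

Lemma sga_mul1l : left_id sga_one sga_mul.
Proof.
move=> u; apply/ffunP => z; rewrite sga_mulE (bigD1 1%g) //= big1 => [|g g1].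
  by rewrite ffunE eqxx mul1r invg1 mulg1 alg_act1 addr0.
by rewrite ffunE (negPf g1) mul0r.
Qed.

Lemma sga_mul1r : right_id sga_one sga_mul.
Proof.
move=> u; apply/ffunP => z; rewrite sga_mulE (bigD1 z) //= big1 => [|g gz].
  by rewrite ffunE mulgV eqxx rmorph1 mulr1 addr0.
by rewrite ffunE -eq_mulgV1 eq_sym (negPf gz) raddf0 mulr0.
Qed.

Lemma sga_mulDl : left_distributive sga_mul +%R.
Proof.
move=> u v w; apply/ffunP => z; rewrite [RHS]ffunE !sga_mulE -big_split.
by apply: eq_bigr => g _; rewrite ffunE mulrDl.
Qed.

Lemma sga_mulDr : right_distributive sga_mul +%R.
Proof.
move=> u v w; apply/ffunP => z; rewrite [RHS]ffunE !sga_mulE -big_split.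
by apply: eq_bigr => g _; rewrite ffunE raddfD mulrDr.
Qed.

Lemma sga_one_neq0 : sga_one != 0.
Proof.
by apply/eqP => /ffunP/(_ 1%g)/eqP; rewrite !ffunE eqxx oner_eq0.
Qed.

HB.instance Definition _ := GRing.Zmodule_isNzRing.Build sga
  sga_mulA sga_mul1l sga_mul1r sga_mulDl sga_mulDr sga_one_neq0.

Lemma sga_scaleAl (c : k) (u v : sga) : c *: (u * v) = (c *: u) * v.
Proof.
apply/ffunP => z; rewrite ffunE !sga_mulE scaler_sumr.
by apply: eq_bigr => g _; rewrite ffunE scalerAl.
Qed.
HB.instance Definition _ := GRing.Lmodule_isLalgebra.Build k sga
  sga_scaleAl.

Lemma sga_scaleAr (c : k) (u v : sga) : c *: (u * v) = u * (c *: v).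
Proof.
apply/ffunP => z; rewrite ffunE !sga_mulE scaler_sumr.
by apply: eq_bigr => g _; rewrite ffunE linearZ scalerAr.
Qed.
HB.instance Definition _ := GRing.Lalgebra_isAlgebra.Build k sga
  sga_scaleAr.

Lemma smashM a b g h :
  smash a g * smash b h = smash (a * to (sgval g) b) (h * g)%g.
Proof.
apply/ffunP => z; rewrite sga_mulE (bigD1 g) //= big1 => [|g' g'g].
  rewrite !ffunE eqxx addr0.
  have -> : ((z * g^-1)%g == h) = (z == (h * g)%g).
    by apply/eqP/eqP => [<-|->]; rewrite ?mulgK ?mulgKV.
  by case: eqP => // _; rewrite raddf0 mulr0.
by rewrite ffunE (negPf g'g) mul0r.
Qed.

Definition group_sum : sga := \sum_(g : subg_of G) smash 1 g.

End SkewGroupAlgebra.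

Section GelfandKirillov.
Variable k : fieldType.

Definition lspan (V : lmodType k) (S : set V) : set V :=
  [set v | exists d (c : 'I_d -> k) (w : 'I_d -> V),
    (forall i, S (w i)) /\ v = \sum_i c i *: w i].

Definition lbasis (V : lmodType k) (U : set V) d (b : 'I_d -> V) : Prop :=
  U = lspan (range b) /\
  forall c : 'I_d -> k, \sum_i c i *: b i = 0 -> forall i, c i = 0.

Definition finite_dim (V : lmodType k) (U : set V) : Prop :=
  exists d (b : 'I_d -> V), lbasis U b.

(* The number of elements of a basis of U; 0 by convention if U is not a finite
   dimensional subspace. *)
Definition findim (V : lmodType k) (U : set V) : nat :=
  xget 0%N [set d | exists b : 'I_d -> V, lbasis U b].

(* U^0 + U^1 + ... + U^n, with U^0 = k. *)
Definition power_sum (B : algType k) (U : set B) (n : nat) : set B :=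
  lspan [set z | exists w : seq B,
    [/\ (size w <= n)%N, (forall x, x \in w -> U x) & z = \prod_(x <- w) x]].

(* The supremum over all finite dimensional subspaces U of B of
   limsup_n log_n dim (U^0 + ... + U^n). *)
Definition GKdim (R : realType) (B : algType k) : \bar R :=
  ereal_sup [set limn_esup (fun n : nat =>
      (ln (findim (power_sum U n))%:R / ln n%:R)%:E)
    | U in [set U : set B | finite_dim U]].

(* GKdim (B / (S)), where GKdim 0 = -oo by convention. *)
Definition GKdim_quot (R : realType) (B : algType k) (S : set B) : \bar R :=
  if pselect (~ ideal_gen S 1) is left S1
  then GKdim R (alg_quot (proper_ideal_gen S1)) else -oo%E.

Definition pertinency (R : realType) (gT : finGroupType) (A : algType k)
    (to : alg_action gT A) (G : {group gT}) : \bar R :=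
  (GKdim R A - GKdim_quot R [set group_sum to G])%E.

End GelfandKirillov.

Definition transp4 (i j : nat) : 'S_4 := tperm (inord i) (inord j).

(* <(1 2)(3 4), (1 3)(2 4)>, with the points numbered from 0. *)
Definition klein4 : {group 'S_4} :=
  <<[set (transp4 0 1 * transp4 2 3)%g; (transp4 0 2 * transp4 1 3)%g]%SET>>%G.

(* Main.v *)
(* [GKdim A = 4]: up to sign every word in the generators is an ordered
   monomial, which bounds the growth from above; for the lower bound, sending
   [x_i] to [t ^ (M ^ i) Y_i] with anticommuting involutory matrices [Y_i] sends
   the even monomials with exponents [2 d_i], [d_i < M], to distinct powers of
   [t ^ 2].

   [(A # G) / (f)] has Gelfand-Kirillov dimension 0. It is nonzero because an
   augmentation of [A] maps it onto [k G / (f)]. It is finite dimensional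
   because all [x_i ^ 4] vanish in it. To see this, let [z_chi] be the
   eigenvectors of [G] in degree 1 and [e_chi] the idempotents of [k G], so that
   [z_chi e_psi = e_(chi psi) z_chi], and [e_1 = 0] in the quotient. The squares
   [z_chi ^ 2] are all equal to [x_1 ^ 2 + ... + x_4 ^ 2], which is therefore 0:
   it annihilates every [e_chi], since [z_chi e_chi = e_1 z_chi = 0]. With
   [l = z_1] and with [X], [Y] the sums of the [z_chi e_psi] that rotate the
   three nontrivial characters in either direction, the remaining relations are
   [l ^ 2 = X Y = Y X = 0], [X ^ 2 = l Y + Y l] and [Y ^ 2 = l X + X l]. These
   give [X ^ 4 = Y ^ 4 = 0], and [4 x_1 = l + X + Y] satisfies
   [(4 x_1) ^ 2 = 2 (X ^ 2 + Y ^ 2)]. *)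
Require Import Defs.
From HB Require Import structures.
From mathcomp Require Import all_boot all_order all_algebra all_fingroup.
From mathcomp Require Import generic_quotient.
From mathcomp.multinomials Require Import monalg.
From mathcomp Require Import all_classical all_reals all_analysis.
Import Order.TTheory GRing.Theory Num.Theory.
Local Open Scope ring_scope.

(** * Dimension and growth *)

Section Dimension.
Set Implicit Arguments.
Unset Strict Implicit.
Local Open Scope classical_set_scope.
Variables (k : fieldType) (V : lmodType k).
Implicit Types (S T W : set V) (u v : V).

Lemma lspan_range (I : finType) (b : I -> V) v :
  lspan (range b) v <-> exists c : I -> k, v = \sum_i c i *: b i.
Proof.
split=> [[d [c [w [bw ->]]]]|[c ->]].
  have /choice [f fP] : forall i, exists j, w i = b j.
    by move=> i; have [j _ <-] := bw i; exists j.
  exists (fun j => \sum_(i | f i == j) c i).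
  rewrite (partition_big f predT) //=; apply: eq_bigr => j _.
  by rewrite scaler_suml; apply: eq_bigr => i /eqP <-; rewrite fP.
exists #|I|, (c \o enum_val), (b \o enum_val); split=> [i|].
  by exists (enum_val i).
by rewrite (reindex _ (onW_bij _ (@enum_val_bij I))).
Qed.

Lemma sub_lspan S : S `<=` lspan S.
Proof.
move=> v Sv; exists 1%N, (fun=> 1), (fun=> v); split=> //.
by rewrite big_ord1 scale1r.
Qed.

Lemma lspan0 S : lspan S 0.
Proof.
exists 0%N, (fun=> 0), (fun=> 0); rewrite big_ord0.
by split=> // -[].
Qed.

Lemma lspanD S u v : lspan S u -> lspan S v -> lspan S (u + v).
Proof.
move=> [m [c [x [Sx ->]]]] [n [d [y [Sy ->]]]].
exists (m + n)%N,
  (fun i => match fintype.split i with inl i => c i | inr i => d i end),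
  (fun i => match fintype.split i with inl i => x i | inr i => y i end).
split=> [i|]; first by case: (fintype.split i).
rewrite big_split_ord; congr (_ + _); apply: eq_bigr => i _.
  by rewrite (unsplitK (inl i)).
by rewrite (unsplitK (inr i)).
Qed.

Lemma lspanZ S a v : lspan S v -> lspan S (a *: v).
Proof.
move=> [m [c [x [Sx ->]]]]; exists m, (fun i => a * c i), x; split=> //.
by rewrite scaler_sumr; apply: eq_bigr => i _; rewrite scalerA.
Qed.

Lemma lspan_sum S (I : Type) (r : seq I) (P : pred I) (F : I -> V) :
  (forall i, P i -> lspan S (F i)) -> lspan S (\sum_(i <- r | P i) F i).
Proof.
by move=> SF; elim/big_rec: _ => [|i x Pi]; [exact: lspan0|apply/lspanD/SF].
Qed.

Lemma lspan_min S T : S `<=` lspan T -> lspan S `<=` lspan T.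
Proof.
move=> ST _ [d [c [w [Sw ->]]]]; apply: lspan_sum => i _.
exact/lspanZ/ST/Sw.
Qed.

Definition lin_indep d (v : 'I_d -> V) :=
  forall c : 'I_d -> k, \sum_i c i *: v i = 0 -> forall i, c i = 0.

Lemma lin_indep_leq d (v : 'I_d -> V) (I : finType) (b : I -> V) :
  lin_indep v -> (forall i, lspan (range b) (v i)) -> (d <= #|I|)%N.
Proof.
move=> v_free vb.
have /choice [M MP] : forall i, exists c : I -> k, v i = \sum_j c j *: b j.
  by move=> i; apply/lspan_range.
pose A := \matrix_(i < d, j < #|I|) M i (enum_val j).
have /row_freeP [B AB] : row_free A.
  apply: inj_row_free => c cA; apply/rowP => i; rewrite mxE.
  apply: (v_free (c 0)); under eq_bigr => l _ do rewrite MP scaler_sumr.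
  rewrite exchange_big big1 //= => j _.
  have := congr1 (fun B : 'rV_ _ => B 0 (enum_rank j)) cA.
  rewrite !mxE => cA0; rewrite -[RHS](scale0r (b j)) -[in RHS]cA0 scaler_suml.
  apply: eq_bigr => l _.
  by rewrite mxE enum_rankK scalerA.
have := mulmx_max_rank A B.
by rewrite AB mxrank1.
Qed.

Lemma findim_le S (I : finType) (b : I -> V) :
  S `<=` lspan (range b) -> (findim S <= #|I|)%N.
Proof.
move=> Sb; rewrite /findim; case: xgetP => // d _ [v [Sv v_free]].
apply: (@lin_indep_leq _ v) => // i; apply: Sb; rewrite Sv; apply: sub_lspan.
by exists i.
Qed.

Lemma lspan_basis S (I : finType) (b : I -> V) :
  S `<=` lspan (range b) -> exists d (v : 'I_d -> V), lbasis (lspan S) v.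
Proof.
move=> /lspan_min Sb.
pose P d := `[< exists v : 'I_d -> V, lin_indep v /\ forall i, lspan S (v i) >].
have P0 : exists d, P d.
  by exists 0%N; apply/asboolP; exists (fun=> 0); split=> [? _|] [].
have Pb d : P d -> (d <= #|I|)%N.
  move/asboolP => [v [v_free vS]].
  by apply: lin_indep_leq v_free _ => i; apply: Sb.
case: (ex_maxnP P0 Pb) => d /asboolP [v [v_free vS]] dmax.
exists d, v; split=> //; apply/seteqP; split; last first.
  by apply: lspan_min => _ [i _ <-].
move=> w Sw; apply: contrapT => wv.
suff /dmax : P d.+1 by rewrite ltnn.
apply/asboolP; exists (fun i => oapp v w (unlift ord0 i)); split; last first.
  by move=> i; case: unliftP => /=.
move=> c; rewrite big_ord_recl unlift_none /=.
under eq_bigr => i _ do rewrite liftK /=.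
move=> c0; have c00 : c ord0 = 0.
  apply/eqP/negP => /negP c_neq0; apply: wv; apply/lspan_range.
  exists (fun i => - (c ord0)^-1 * c (lift ord0 i)).
  have /addr0_eq cw := c0.
  rewrite -[LHS]scale1r -(mulVf c_neq0) -scalerA -[c _ *: w]opprK cw.
  rewrite scalerN -scaleNr scaler_sumr; apply: eq_bigr => i _.
  by rewrite scalerA.
move: c0; rewrite c00 scale0r add0r => /v_free c0 i.
by case: (unliftP ord0 i) => [j ->|->].
Qed.

Lemma findim_ge S (I : finType) (b : I -> V) d (v : 'I_d -> V) :
  S `<=` lspan (range b) -> lin_indep v -> (forall i, lspan S (v i)) ->
  (d <= findim (lspan S))%N.
Proof.
move=> /lspan_basis ex_b v_free vS; rewrite /findim.
case: xgetP => [e _ [w [wS _]]|no_b]; last first.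
  by have [e [w we]] := ex_b; case: (no_b e); exists w.
have := @lin_indep_leq _ v _ w v_free; rewrite card_ord; apply=> i.
by rewrite -wS.
Qed.

End Dimension.
Section Growth.
Set Implicit Arguments.
Unset Strict Implicit.
Local Open Scope classical_set_scope.
Variable R : realType.
Implicit Types (u : (\bar R)^nat) (f : nat -> nat).

Lemma limn_esup_le_near u (l : R) :
  (forall e, 0 < e -> \forall n \near \oo, (u n <= (l + e)%:E)%E) ->
  (limn_esup u <= l%:E)%E.
Proof.
move=> ul; apply/lee_addgt0Pr => e /ul ule; rewrite /limn_esup limf_esupE.
apply: ge_ereal_inf; exists (ereal_sup (u @` [set n | (u n <= (l + e)%:E)%E])).
  by exists [set n | (u n <= (l + e)%:E)%E].
by apply: ge_ereal_sup => _ [n un <-]; rewrite -EFinD.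
Qed.

Lemma limn_esup_ge_near u (l : R) :
  (forall e, 0 < e -> \forall n \near \oo, ((l - e)%:E <= u n)%E) ->
  (l%:E <= limn_esup u)%E.
Proof.
move=> ul; apply/lee_subgt0Pr => e /ul ule; rewrite /limn_esup limf_esupE.
apply: le_ereal_inf_tmp => _ [V Voo <-].
have [n [un Vn]] : exists n, ((l - e)%:E <= u n)%E /\ V n.
  exact: (filter_ex (filterI ule Voo)).
by apply: (le_trans un); apply: ereal_sup_ubound; exists n.
Qed.

Lemma near_ln_ge (a : R) : \forall n \near \oo, a <= ln (n%:R : R).
Proof.
near=> n.
have n_gt0 : 0 < (n%:R : R).
  apply: (lt_le_trans (expR_gt0 a)); near: n; exact: (cvgry_ge cvgr_idn).
rewrite -[a]expRK ler_ln ?posrE ?expR_gt0 //.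
near: n; exact: (cvgry_ge cvgr_idn).
Unshelve. all: by end_near. Qed.

Definition log_growth f : (\bar R)^nat := fun n => (ln (f n)%:R / ln n%:R)%:E.

Lemma log_growth_le f d c : (0 < c)%N ->
  (forall n, (0 < n)%N -> (f n <= c * n ^ d)%N) ->
  (limn_esup (log_growth f) <= d%:R%:E)%E.
Proof.
move=> c0 fc; apply: limn_esup_le_near => e e0; near=> n.
have ln_ge1 : 1 <= ln (n%:R : R) by near: n; exact: near_ln_ge.
have lne : ln c%:R / e <= ln (n%:R : R) by near: n; exact: near_ln_ge.
have n0 : (0 < n)%N by near: n; exact: nbhs_infty_gt.
rewrite lee_fin ler_pdivrMr ?(lt_le_trans ltr01) // mulrDl.
have lnf : ln (f n)%:R <= ln (c * n ^ d)%:R :> R.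
  case: (posnP (f n)) => [->|fn0].
    rewrite ln0 ?lexx //; apply: ln_ge0; rewrite ler1n.
    by rewrite muln_gt0 c0 expn_gt0 n0.
  by rewrite ler_ln ?posrE ?ltr0n ?ler_nat ?muln_gt0 ?c0 ?expn_gt0 ?n0 // fc.
apply: (le_trans lnf); rewrite natrM natrX lnM ?posrE ?exprn_gt0 ?ltr0n //.
rewrite lnXn ?ltr0n // -[_ *+ d]mulr_natl [leLHS]addrC lerD2l mulrC.
by rewrite -ler_pdivrMr.
Unshelve. all: by end_near. Qed.

Lemma log_growth_ge f d c : (0 < c)%N ->
  (forall n, (0 < n)%N -> (n ^ d <= c * f n)%N) ->
  (d%:R%:E <= limn_esup (log_growth f))%E.
Proof.
move=> c0 fc; apply: limn_esup_ge_near => e e0; near=> n.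
have ln_ge1 : 1 <= ln (n%:R : R) by near: n; exact: near_ln_ge.
have lne : ln c%:R / e <= ln (n%:R : R) by near: n; exact: near_ln_ge.
have n0 : (0 < n)%N by near: n; exact: nbhs_infty_gt.
rewrite lee_fin ler_pdivlMr ?(lt_le_trans ltr01) // mulrBl lerBlDr.
have /(leq_trans _) := fc n n0 => /(_ 1%N); rewrite expn_gt0 n0 => /(_ isT).
rewrite muln_gt0 => /andP[_ fn0].
have : ln (n ^ d)%:R <= ln (c * f n)%:R :> R.
  by rewrite ler_ln ?posrE ?ltr0n ?ler_nat ?muln_gt0 ?c0 ?expn_gt0 ?n0 // fc.
rewrite natrM natrX lnM ?posrE ?ltr0n // lnXn ?ltr0n // -[_ *+ d]mulr_natl.
move=> /le_trans; apply.
by rewrite [leLHS]addrC lerD2l mulrC -ler_pdivrMr.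
Unshelve. all: by end_near. Qed.

End Growth.
Section PowerSums.
Set Implicit Arguments.
Unset Strict Implicit.
Local Open Scope classical_set_scope.
Variables (k : fieldType) (B : algType k).
Implicit Types (S U : set B).

Lemma power_sum1 S n : power_sum S n 1.
Proof. by apply: sub_lspan; exists [::]; rewrite big_nil. Qed.

Lemma power_sumS S m n : (m <= n)%N -> power_sum S m `<=` power_sum S n.
Proof.
move=> mn; apply: lspan_min => z [w [wm wS ->]]; apply: sub_lspan.
by exists w; split=> //; apply: leq_trans mn.
Qed.

Lemma power_sumM S m n u v :
  power_sum S m u -> power_sum S n v -> power_sum S (m + n) (u * v).
Proof.
move=> [d [c [x [Sx ->]]]] [e [a [y [Sy ->]]]].
rewrite mulr_suml; apply: lspan_sum => i _.
rewrite mulr_sumr; apply: lspan_sum => j _.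
rewrite -scalerAl -scalerAr; do 2!apply: lspanZ; apply: sub_lspan.
have [s [sm sS ->]] := Sx i; have [t [tn tS ->]] := Sy j.
exists (s ++ t); rewrite size_cat leq_add //; split=> // [z|].
  by rewrite mem_cat => /orP[/sS|/tS].
by rewrite big_cat.
Qed.

Lemma power_sumX S m n u : power_sum S m u -> power_sum S (m * n) (u ^+ n).
Proof.
move=> Su; elim: n => [|n IHn]; first exact: power_sum1.
by rewrite exprS mulnS; apply: power_sumM.
Qed.

Lemma power_sum_prod S m n (F : 'I_n -> B) :
  (forall i, power_sum S m (F i)) -> power_sum S (m * n) (\prod_i F i).
Proof.
elim: n F => [|n IHn] F SF; first by rewrite big_ord0; apply: power_sum1.
by rewrite big_ord_recl mulnS; apply: power_sumM (SF _) (IHn _ _).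
Qed.

Lemma power_sum_gen S u : S u -> power_sum S 1 u.
Proof.
move=> Su; apply: sub_lspan; exists [:: u]; rewrite big_seq1; split=> // x.
by rewrite mem_seq1 => /eqP->.
Qed.

Lemma power_sum_sub S U m n :
  U `<=` power_sum S m -> power_sum U n `<=` power_sum S (m * n).
Proof.
move=> US; apply: lspan_min => _ [w [wn wU ->]].
apply: (@power_sumS _ (m * size w)); first by rewrite leq_mul2l wn orbT.
elim: w {wn} wU => [|x w IHw] wU; first by rewrite big_nil; apply: power_sum1.
rewrite big_cons mulnS; apply: power_sumM; first exact/US/wU/mem_head.
by apply: IHw => y yw; apply: wU; rewrite in_cons yw orbT.
Qed.

Lemma finite_dim_power_sum S U : (forall u, exists m, power_sum S m u) ->
  finite_dim U -> exists2 m, (0 < m)%N & U `<=` power_sum S m.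
Proof.
move=> S_gen [d [b [-> _]]].
have /choice [m mP] : forall i, exists m, power_sum S m (b i) by [].
exists (\max_i m i).+1 => //; apply: lspan_min => _ [i _ <-].
by apply: (power_sumS (leqW (leq_bigmax i))) (mP i).
Qed.

End PowerSums.

Section GKdimBounds.
Set Implicit Arguments.
Unset Strict Implicit.
Local Open Scope classical_set_scope.
Variables (R : realType) (k : fieldType) (B : algType k).

Lemma finite_dim0 : finite_dim [set 0 : B].
Proof.
exists 0%N, (fun=> 0); split=> [|c _ []//].
apply/seteqP; split=> [_ ->|x /lspan_range [c ->]]; first exact: lspan0.
by rewrite big_ord0.
Qed.

Lemma GKdim_fin (I : finType) (b : I -> B) :
  (forall u, lspan (range b) u) -> GKdim R B = 0%E.
Proof.
move=> b_gen; apply/eqP; rewrite eq_le; apply/andP; split.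
  apply: ge_ereal_sup => _ [U _ <-].
  pose f n := findim (power_sum U n).
  apply: (@log_growth_le R f 0 #|I|.+1) => // n _.
  by rewrite muln1; apply/leqW/(findim_le (b := b)).
apply: le_trans (ereal_sup_ubound _); last first.
  by exists [set 0]; [exact: finite_dim0|reflexivity].
apply: limf_esup_ge0 => [|n]; first exact: filter_not_empty.
have ln_nat_ge0 m : 0 <= ln (m%:R : R).
  by case: m => [|m]; [rewrite ln0|rewrite ln_ge0 // ler1n].
by rewrite lee_fin divr_ge0.
Qed.

Lemma GKdim_le d (S : set B) c :
  (forall u, exists m, power_sum S m u) ->
  (forall n, (0 < n)%N ->
    exists (I : finType) (b : I -> B),
      power_sum S n `<=` lspan (range b) /\ (#|I| <= c * n ^ d)%N) ->
  (GKdim R B <= d%:R%:E)%E.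
Proof.
move=> S_gen Sc; apply: ge_ereal_sup => _ [U Ufin <-].
have [m m0 Um] := finite_dim_power_sum S_gen Ufin.
pose f n := findim (power_sum U n).
apply: (@log_growth_le R f d (c * m ^ d).+1) => // n n0.
have [|I [b [Sb Ic]]] := Sc (m * n)%N; first by rewrite muln_gt0 m0.
apply: leq_trans (findim_le (b := b) _) _.
  by apply: subset_trans Sb; apply: power_sum_sub.
apply: (leq_trans Ic); rewrite expnMn mulnA leq_mul2r.
by rewrite leqW ?orbT.
Qed.

Lemma GKdim_ge d (U : set B) c : (0 < c)%N -> finite_dim U ->
  (forall n, (0 < n)%N ->
    exists (I : finType) (b : I -> B) e (v : 'I_e -> B),
    [/\ power_sum U n `<=` lspan (range b), lin_indep v,
        forall i, power_sum U n (v i) & (n ^ d <= c * e)%N]) ->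
  (d%:R%:E <= GKdim R B)%E.
Proof.
move=> c0 Ufin Uc; apply: le_trans (ereal_sup_ubound _); last first.
  by exists U; [exact: Ufin|reflexivity].
apply: (@log_growth_ge R (fun n => findim (power_sum U n)) d c) => // n n0.
have [I [b [e [v [Ub v_free vU nce]]]]] := Uc n n0.
apply: (leq_trans nce); rewrite leq_mul2l; apply/orP; right.
apply: findim_ge v_free vU; apply: subset_trans Ub; exact: sub_lspan.
Qed.

End GKdimBounds.

Section Anticommuting.
Set Implicit Arguments.
Unset Strict Implicit.
Local Open Scope classical_set_scope.
Variables (k : fieldType) (B : algType k) (n : nat) (X : 'I_n -> B).
Hypothesis XC : forall i j, i != j -> X i * X j + X j * X i = 0.

Let word (s : seq 'I_n) : B := \prod_(i <- s) X i.

Definition ordered_word (a : 'I_n -> nat) : seq 'I_n :=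
  flatten [seq nseq (a i) i | i <- enum 'I_n].

Definition ordered_monomial (a : 'I_n -> nat) : B :=
  \prod_(i <- ordered_word a) X i.

Lemma count_ordered_word a i : count_mem i (ordered_word a) = a i.
Proof.
rewrite /ordered_word count_flatten -map_comp.
rewrite (eq_map (g := fun j => (j == i) * a j)%N); last first.
  by move=> j /=; rewrite count_nseq /= mulnC.
rewrite sumnE big_map big_enum /= (bigD1 i) //= eqxx mul1n big1 ?addn0 // => j.
by move=> /negPf ->.
Qed.

Lemma perm_ordered_word s :
  perm_eq s (ordered_word (fun i => count_mem i s)).
Proof. by apply/allP => i _; rewrite /= count_ordered_word. Qed.

Lemma word_swap1 i s : exists e, word (i :: s) = (-1) ^+ e *: word (rcons s i).
Proof.
elim: s => [|j s [e IHs]]; first by exists 0%N; rewrite scale1r.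
rewrite /word rcons_cons !big_cons in IHs *.
have [->|ij] := eqVneq j i; first by exists e; rewrite IHs scalerAr.
exists e.+1; rewrite mulrA; have -> : X i * X j = - (X j * X i).
  by apply/eqP; rewrite -addr_eq0 XC // eq_sym.
by rewrite exprS mulN1r scaleNr mulNr -mulrA IHs scalerAr.
Qed.

Lemma word_swap s t : exists e, word (s ++ t) = (-1) ^+ e *: word (t ++ s).
Proof.
elim: s t => [|i s IHs] t; first by exists 0%N; rewrite cats0 scale1r.
have [e est] := IHs (rcons t i); have [d dst] := word_swap1 i (s ++ t).
exists (d + e)%N; rewrite -cat_rcons exprD -scalerA -est -rcons_cat -dst.
by [].
Qed.

Lemma word_perm s t : perm_eq s t ->
  exists e, word s = (-1) ^+ e *: word t.
Proof.
move=> st.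
apply: (catCA_perm_ind (P := fun t => exists e, _ = _ *: word t)) st _.
  move=> s1 s2 s3 [e ->]; have [d ds] := word_swap s1 s2.
  exists (e + d)%N; rewrite /word !catA !big_cat /= -[in LHS]big_cat.
  by rewrite [X in X * _]ds -scalerAl scalerA exprD /word big_cat.
by exists 0%N; rewrite scale1r.
Qed.

Lemma word_ordered s :
  exists e, word s = (-1) ^+ e *: ordered_monomial (fun i => count_mem i s).
Proof. exact/word_perm/perm_ordered_word. Qed.

Lemma ordered_monomial_eq0 i a : (forall s, word (nseq a i ++ s) = 0) ->
  forall b, (a <= b i)%N -> ordered_monomial b = 0.
Proof.
move=> Xi0 b ab; pose s := [seq j <- ordered_word b | j != i].
have [|e] := @word_perm (ordered_word b) (nseq a i ++ nseq (b i - a) i ++ s).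
  rewrite catA -nseqD subnKC //; apply/allP => j _ /=.
  rewrite count_cat count_nseq count_filter count_ordered_word /=.
  have [->|ji] := eqVneq i j.
    rewrite mul1n (eq_count (a2 := pred0)) ?count_pred0 ?addn0 // => l /=.
    by case: eqP.
  rewrite mul0n add0n (eq_count (a2 := pred1 j)) ?count_ordered_word // => l /=.
  by case: eqP => // ->; rewrite eq_sym ji.
by rewrite Xi0 scaler0.
Qed.

Lemma power_sum_ordered m :
  power_sum (range X) m `<=`
  lspan (range (fun a : {ffun 'I_n -> 'I_m.+1} =>
    ordered_monomial (fun i => a i))).
Proof.
apply: lspan_min => _ [w [wm wX ->]].
have [s sw] : exists s, w = map X s.
  elim: w wX {wm} => [|x w IHw] wX; first by exists [::].
  have [j _ Xj] := wX x (mem_head x w).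
  case: IHw => [y yw|s ->]; first by apply: wX; rewrite in_cons yw orbT.
  by exists (j :: s); rewrite /= Xj.
rewrite sw big_map -/(word s); have [e ->] := word_ordered s.
apply/lspanZ/sub_lspan.
exists [ffun i => inord (count_mem i s)] => //; congr ordered_monomial.
apply/funext => i; rewrite ffunE inordK // ltnS.
by rewrite (leq_trans (count_size _ _)) // -(size_map X) -sw.
Qed.

End Anticommuting.

(** * The skew polynomial algebra *)

Section AnticommutingInvolutions.
Set Implicit Arguments.
Unset Strict Implicit.
Variable k : fieldType.

Lemma anticommuting_involutions n : exists N (Y : 'I_n -> 'M[k]_N.+1),
  (forall i j, i != j -> Y i * Y j + Y j * Y i = 0) /\ (forall i, Y i ^+ 2 = 1).
Proof.
elim: n => [|n [N [Y [YC Y2]]]]; first by exists 0%N, (fun=> 1); split=> -[].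
pose Z (i : 'I_n.+1) : 'M[k]_(N.+1 + N.+1) :=
  if unlift ord0 i is Some j then block_mx (Y j) 0 0 (- Y j)
  else block_mx 0 1%:M 1%:M 0.
have Z0 : Z ord0 = block_mx 0 1%:M 1%:M 0 by rewrite /Z unlift_none.
have ZS j : Z (lift ord0 j) = block_mx (Y j) 0 0 (- Y j) by rewrite /Z liftK.
have ZC0 j : Z ord0 *m Z (lift ord0 j) + Z (lift ord0 j) *m Z ord0 = 0.
  rewrite Z0 ZS !mulmx_block add_block_mx !mulmx0 !mul0mx !mul1mx !mulmx1.
  by rewrite !addr0 !add0r subrr addNr block_mx0.
have ZC i j : i != j -> Z i *m Z j + Z j *m Z i = 0.
  case: (unliftP ord0 i) => [i' ->|->]; case: (unliftP ord0 j) => [j' ->|->] ij.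
  - rewrite !ZS !mulmx_block add_block_mx !mulmx0 !mul0mx !addr0 !add0r.
    by rewrite !mulmxN !mulNmx !opprK YC ?block_mx0.
  - by rewrite addrC.
  - exact: ZC0.
  - by rewrite eqxx in ij.
exists (N + N.+1)%N, Z; split=> [i j /ZC//|i].
suff: Z i *m Z i = 1%:M by [].
case: (unliftP ord0 i) => [j ->|->]; rewrite ?ZS ?Z0 mulmx_block.
  rewrite !mulmx0 !mul0mx !addr0 !add0r mulmxN mulNmx opprK.
  have -> : Y j *m Y j = 1%:M by apply: Y2.
  by rewrite -scalar_mx_block.
rewrite !(mulmx0, mul0mx, mulmx1, addr0, add0r).
by rewrite -scalar_mx_block.
Qed.

End AnticommutingInvolutions.

Lemma sum_digits M n j :
  (\sum_(i < n) (j %/ M ^ i %% M) * M ^ i = j %% M ^ n)%N.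
Proof.
elim: n => [|n IHn]; first by rewrite big_ord0 modn1.
rewrite big_ord_recr /= IHn expnSr.
case: (posnP M) => [->|M0]; first by rewrite muln0 !modn0 addnC -divn_eq.
have Mn0 : (0 < M ^ n)%N by rewrite expn_gt0 M0.
rewrite [in RHS](divn_eq j (M ^ n)) [in RHS](divn_eq (j %/ M ^ n) M).
rewrite mulnDl -mulnA [(M * _)%N]mulnC -addnA modnMDl addnC [RHS]modn_small //.
apply: (@leq_trans ((j %/ M ^ n %% M).+1 * M ^ n)%N).
  by rewrite mulSn addnC ltn_add2r ltn_mod.
by rewrite mulnC leq_mul2l ltn_mod M0 orbT.
Qed.

Lemma natr_inj (F : fieldType) : [pchar F] =i pred0 ->
  injective (fun m : nat => m%:R : F).
Proof.
move=> /pcharf0P F0 a b; wlog ab : a b / (a <= b)%N => [hw ba|/eqP].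
  by case/orP: (leq_total a b) => ab; [|symmetry]; apply: hw.
rewrite eq_sym -subr_eq0 -natrB // F0 subn_eq0 => ba.
by apply/eqP; rewrite eqn_leq ab.
Qed.

Section SkewAlgebra.
Set Implicit Arguments.
Unset Strict Implicit.
Local Open Scope classical_set_scope.
Variables (k : fieldType) (n : nat).
Local Notation A := (skew_alg k n).

Section Lift.
Variables (B : algType k) (x : 'I_n -> B).

Lemma free_lift_power_sum p : exists m, power_sum (range x) m (free_lift x p).
Proof.
rewrite /free_lift /mmap; elim/big_rec: _ => [|w u _ [m IHm]].
  by exists 0%N; apply: lspan0.
exists (maxn (size (w : {fmonom 'I_n})) m); apply: lspanD; last first.
  by apply: power_sumS IHm; apply: leq_maxr.
rewrite mulr_algl; apply: lspanZ; apply: (power_sumS (leq_maxl _ _)).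
apply: sub_lspan; exists (map x w); rewrite size_map; split=> // [y|].
  by move=> /mapP[i _ ->]; exists i.
by rewrite big_map.
Qed.

Definition skew_lift (xP : forall i j, i != j -> x i * x j + x j * x i = 0) :
  A -> B := fun p => free_lift x (repr p).

Variable xP : forall i j, i != j -> x i * x j + x j * x i = 0.

Lemma skew_liftE (p : free_alg k n) :
  skew_lift xP (to_quot (proper_ideal_gen (@skew_rels_proper k n)) p) =
  free_lift x p.
Proof. exact: skew_lift_to_quot xP p. Qed.

Lemma skew_lift_is_linear : linear (skew_lift xP).
Proof.
move=> c p q; rewrite -(to_quotK p) -(to_quotK q).
rewrite -[X in X + _]to_quotZ -[X in skew_lift xP X]to_quotD !skew_liftE.
exact: free_lift_is_linear.
Qed.
HB.instance Definition _ := GRing.isLinear.Build k A B _ (skew_lift xP)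
  skew_lift_is_linear.

Lemma skew_lift_is_monoid_morphism : monoid_morphism (skew_lift xP).
Proof.
split=> [|p q]; first by rewrite skew_liftE rmorph1.
by rewrite -(to_quotK p) -(to_quotK q) -rmorphM !skew_liftE rmorphM.
Qed.
HB.instance Definition _ := GRing.isMonoidMorphism.Build A B (skew_lift xP)
  skew_lift_is_monoid_morphism.

Lemma skew_lift_gen i : skew_lift xP (skew_gen k i) = x i.
Proof. by rewrite skew_liftE free_lift_gen. Qed.

End Lift.

Lemma skew_alg_gen (u : A) : exists m, power_sum (range (@skew_gen k n)) m u.
Proof.
have [m] := free_lift_power_sum (@skew_gen k n) (repr u).
have <- := @free_lift_uniq k n A (@skew_gen k n) (to_quot _) (fun=> erefl)
  (repr u).
by rewrite /= to_quotK; exists m.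
Qed.

Lemma skew_power_sum_ordered m :
  power_sum (range (@skew_gen k n)) m `<=`
  lspan (range (fun a : {ffun 'I_n -> 'I_m.+1} =>
    ordered_monomial (@skew_gen k n) (fun i => a i))).
Proof. exact/power_sum_ordered/skew_genP. Qed.

Lemma GKdim_skew_alg_le (R : realType) : (GKdim R A <= n%:R%:E)%E.
Proof.
apply: (@GKdim_le R k A n (range (@skew_gen k n)) (2 ^ n) skew_alg_gen) => m m0.
exists {ffun 'I_n -> 'I_m.+1}.
exists (fun a : {ffun 'I_n -> 'I_m.+1} =>
  ordered_monomial (@skew_gen k n) (fun i => a i)).
split; first exact: skew_power_sum_ordered.
rewrite card_ffun !card_ord -expnMn; case: (posnP n) => [->//|n0].
by rewrite leq_exp2r // mul2n -addnn -addn1 leq_add2l.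
Qed.

Definition kronecker_monomial (M j : nat) : A :=
  \prod_(i < n) skew_gen k i ^+ (2 * (j %/ M ^ i %% M)).

Lemma kronecker_monomial_indep M : [pchar k] =i pred0 -> (0 < M)%N ->
  lin_indep (fun j : 'I_(M ^ n) => kronecker_monomial M j).
Proof.
move=> k0 M0 c cv.
have [N [Y [YC Y2]]] := anticommuting_involutions k n.
pose p := \poly_(j < M ^ n) (oapp c 0 (insub j)).
have pE (t : k) : p.[t ^+ 2] = 0.
  pose x (i : 'I_n) : 'M[k]_N.+1 := t ^+ (M ^ i) *: Y i.
  have xP i j : i != j -> x i * x j + x j * x i = 0.
    move=> ij; rewrite /x -!scalerAl -!scalerAr !scalerA [X in _ + X *: _]mulrC.
    by rewrite -scalerDr YC // scaler0.
  have fE (j : 'I_(M ^ n)) :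
      skew_lift xP (kronecker_monomial M j) = (t ^+ 2 ^+ j)%:A.
    rewrite rmorph_prod /=.
    under eq_bigr => i _.
      rewrite rmorphXn /= skew_lift_gen exprM exprZn Y2 exprZn expr1n.
      rewrite -!exprM; over.
    rewrite -[RHS]/(in_alg _ _) -[in RHS](modn_small (ltn_ord j)).
    rewrite -[in RHS]sum_digits -prodrXr rmorph_prod /=; apply: eq_bigr => i _.
    rewrite -exprM; congr (_ ^+ _ *: _).
    by rewrite mulnCA [(M ^ i * _)%N]mulnC.
  have := congr1 (skew_lift xP) cv; rewrite linear_sum /= raddf0.
  under eq_bigr => j _ do rewrite linearZ /= fE scalerA.
  rewrite -scaler_suml => /eqP; rewrite scaler_eq0 oner_eq0 orbF => /eqP <-.
  rewrite horner_poly; apply: eq_bigr => j _; congr (_ * _).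
  by rewrite valK.
suff p0 : p = 0.
  move=> i; have := coef_poly (M ^ n) (fun j => oapp c 0 (insub j)) i.
  by rewrite -/p p0 coef0 ltn_ord valK.
pose rs := [seq (m%:R : k) ^+ 2 | m <- iota 0 (M ^ n)].
apply: (@roots_geq_poly_eq0 _ p rs).
- by apply/allP => _ /mapP[m _ ->]; apply/rootP.
- rewrite map_inj_uniq ?iota_uniq // => a b.
  rewrite -!natrX => /(natr_inj k0)/eqP.
  by rewrite eqn_exp2r // => /eqP.
by rewrite size_map size_iota size_poly.
Qed.

Lemma GKdim_skew_alg (R : realType) : [pchar k] =i pred0 ->
  GKdim R A = n%:R%:E.
Proof.
move=> k0; apply/eqP; rewrite eq_le GKdim_skew_alg_le /=.
pose S := range (@skew_gen k n); pose K := (2 * n).+1.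
have SU : lspan S `<=` power_sum S 1.
  by apply: lspan_min => u Su; apply: power_sum_gen.
have US : S `<=` power_sum (lspan S) 1.
  by move=> u Su; apply/power_sum_gen/sub_lspan.
apply: (@GKdim_ge R k A n (lspan S) (K ^ n)); first by rewrite expn_gt0.
  by apply: (lspan_basis (b := @skew_gen k n)); apply: sub_lspan.
move=> m m0; pose M := (m %/ K).+1.
exists {ffun 'I_n -> 'I_(1 * m).+1}.
exists (fun a : {ffun 'I_n -> 'I_(1 * m).+1} =>
  ordered_monomial (@skew_gen k n) (fun i => a i)).
exists (M ^ n)%N, (fun j => kronecker_monomial M j); split.
- by apply: subset_trans (@skew_power_sum_ordered _); apply: power_sum_sub.
- exact: kronecker_monomial_indep.
- move=> j; rewrite -[m]mul1n; apply: (power_sum_sub US).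
  apply: (@power_sumS _ _ _ (2 * (m %/ K) * n)).
    rewrite mulnAC [leqLHS]mulnC; apply: leq_trans (leq_trunc_div m K).
    by rewrite leq_mul2l leqnSn orbT.
  apply: power_sum_prod => i; rewrite -[(2 * (m %/ K))%N]mul1n.
  apply: (@power_sumS _ _ _ (1 * (2 * (j %/ M ^ i %% M)))).
    by rewrite !mul1n leq_mul2l /= -ltnS ltn_mod.
  by apply/power_sumX/power_sum_gen; exists i.
rewrite -expnMn; case: (posnP n) => [->//|n0].
by rewrite leq_exp2r // mulnC ltnW // ltn_ceil.
Qed.

End SkewAlgebra.

(** * The relations of the quotient *)

Section Nilpotency.
Set Implicit Arguments.
Unset Strict Implicit.

Lemma triangle_pow4 (B : nzRingType) (l X Y : B) :
  l * l = 0 -> X * Y = 0 -> Y * X = 0 ->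
  X * X = l * Y + Y * l -> Y * Y = l * X + X * l -> (l + X + Y) ^+ 4 = 0.
Proof.
move=> l2 XY0 YX0 X2 Y2.
have X3 : X * X * X = Y * l * X.
  by rewrite X2 mulrDl -[l * Y * X]mulrA YX0 mulr0 add0r.
have Y3 : Y * Y * Y = Y * l * X.
  by rewrite -mulrA Y2 mulrDr [Y * (X * l)]mulrA YX0 mul0r addr0 mulrA.
have X4 : X * X * (X * X) = 0 by rewrite mulrA X3 -Y3 -mulrA YX0 mulr0.
have Y4 : Y * Y * (Y * Y) = 0 by rewrite mulrA Y3 -X3 -mulrA XY0 mulr0.
have s2 : (l + X + Y) ^+ 2 = (X * X + Y * Y) *+ 2.
  rewrite expr2 !mulrDl !mulrDr l2 XY0 YX0 !(add0r, addr0).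
  rewrite [X in X + _ = _]addrACA [Y * l + _]addrC [LHS]addrACA.
  rewrite [l * Y + _]addrC -[X * X + _ + _]addrA -X2 -Y2.
  by rewrite [LHS]addrACA [Y * Y + _]addrC -mulr2n.
rewrite (exprM _ 2 2) s2 exprMn_n expr2 mulrDl !mulrDr X4 Y4.
rewrite -(mulrA X X) (mulrA X Y) XY0 -(mulrA Y Y) (mulrA Y X) YX0.
by rewrite !(mul0r, mulr0, addr0) mul0rn.
Qed.

Variables (B : nzRingType) (l za zb zc ea eb ec : B).
Hypotheses (ab : ea * eb = 0) (ba : eb * ea = 0) (ac : ea * ec = 0)
  (ca : ec * ea = 0) (bc : eb * ec = 0) (cb : ec * eb = 0).
Hypothesis abc1 : ea + eb + ec = 1.
Hypotheses (la : l * ea = ea * l) (lb : l * eb = eb * l) (lc : l * ec = ec * l).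
Hypotheses (zaa : za * ea = 0) (zab : za * eb = ec * za)
  (zac : za * ec = eb * za).
Hypotheses (zba : zb * ea = ec * zb) (zbb : zb * eb = 0)
  (zbc : zb * ec = ea * zb).
Hypotheses (zca : zc * ea = eb * zc) (zcb : zc * eb = ea * zc)
  (zcc : zc * ec = 0).
Hypotheses (za2 : za * za = l * l) (zb2 : zb * zb = l * l)
  (zc2 : zc * zc = l * l).
Hypotheses (lza : l * za + za * l = zb * zc + zc * zb)
  (lzb : l * zb + zb * l = za * zc + zc * za)
  (lzc : l * zc + zc * l = za * zb + zb * za).

Let aa : ea * ea = ea.
Proof. by rewrite -[RHS]mulr1 -abc1 !mulrDr ab ac !addr0. Qed.
Let bb : eb * eb = eb.
Proof. by rewrite -[RHS]mulr1 -abc1 !mulrDr ba bc addr0 add0r. Qed.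
Let cc : ec * ec = ec.
Proof. by rewrite -[RHS]mulr1 -abc1 !mulrDr ca cb !add0r. Qed.

Let aza : ea * za = 0.
Proof.
rewrite -[LHS]mulr1 -abc1 !mulrDr -!mulrA zaa zab zac !mulrA ac ab.
by rewrite !(mul0r, mulr0, addr0).
Qed.
Let bzb : eb * zb = 0.
Proof.
rewrite -[LHS]mulr1 -abc1 !mulrDr -!mulrA zbb zba zbc !mulrA bc ba.
by rewrite !(mul0r, mulr0, addr0).
Qed.
Let czc : ec * zc = 0.
Proof.
rewrite -[LHS]mulr1 -abc1 !mulrDr -!mulrA zcc zca zcb !mulrA ca cb.
by rewrite !(mul0r, mulr0, addr0).
Qed.

Let l2 : l * l = 0.
Proof.
rewrite -[LHS]mulr1 -abc1 !mulrDr -{1}za2 -{1}zb2 -zc2.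
by rewrite -!mulrA zaa zbb zcc !mulr0 !addr0.
Qed.

(* The two directions of rotation in the triangle with vertices [ea], [eb],
   [ec]: [za], [zb], [zc] exchange two vertices and kill the third one. *)
Let X := za * eb + zb * ec + zc * ea.
Let Y := za * ec + zb * ea + zc * eb.

Let moves := (aza, bzb, czc, =^~ zab, =^~ zac, =^~ zba, =^~ zbc, =^~ zca,
  =^~ zcb).
Let orth := (aa, bb, cc, ab, ac, ba, bc, ca, cb).

Let mulr_mid (x e y f : B) : (x * e) * (y * f) = x * (e * y) * f.
Proof. by rewrite !mulrA. Qed.

Let XY0 : X * Y = 0.
Proof.
rewrite /X /Y !mulrDl !mulrDr !mulr_mid !moves -!mulrA !orth.
rewrite !(mul0r, mulr0, addr0, add0r) !mulrA za2 zb2 zc2 l2.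
by rewrite !mul0r !addr0.
Qed.

Let YX0 : Y * X = 0.
Proof.
rewrite /X /Y !mulrDl !mulrDr !mulr_mid !moves -!mulrA !orth.
rewrite !(mul0r, mulr0, addr0, add0r) !mulrA za2 zb2 zc2 l2.
by rewrite !mul0r !addr0.
Qed.

Let lX : l * X + X * l = (l * za + za * l) * eb + (l * zb + zb * l) * ec +
  (l * zc + zc * l) * ea.
Proof.
rewrite /X mulrDl mulrDr mulrDl mulrDr -!mulrA -la -lb -lc !mulrDl -!mulrA.
by rewrite addrACA; congr (_ + _); rewrite addrACA.
Qed.

Let lY : l * Y + Y * l = (l * za + za * l) * ec + (l * zb + zb * l) * ea +
  (l * zc + zc * l) * eb.
Proof.
rewrite /Y mulrDl mulrDr mulrDl mulrDr -!mulrA -la -lb -lc !mulrDl -!mulrA.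
by rewrite addrACA; congr (_ + _); rewrite addrACA.
Qed.

Let X2 : X * X = l * Y + Y * l.
Proof.
rewrite lY lza lzb lzc /X !mulrDl !mulrDr !mulr_mid !moves -!mulrA !orth.
rewrite zaa zbb zcc !(mul0r, mulr0, addr0, add0r).
by rewrite [LHS]addrC addrA.
Qed.

Let Y2 : Y * Y = l * X + X * l.
Proof.
rewrite lX lza lzb lzc /Y !mulrDl !mulrDr !mulr_mid !moves -!mulrA !orth.
rewrite zaa zbb zcc !(mul0r, mulr0, addr0, add0r).
by rewrite -addrA addrC.
Qed.

Lemma rotation_sum_pow4 : (l + za + zb + zc) ^+ 4 = 0.
Proof.
have zXY : za + zb + zc = X + Y.
  rewrite -[za]mulr1 -[zb]mulr1 -[zc]mulr1 -abc1 !mulrDr zaa zbb zcc.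
  rewrite !(addr0, add0r) [zb * ea + _]addrC.
  by rewrite [X in X + _ = _]addrACA [LHS]addrACA.
have -> : l + za + zb + zc = l + X + Y.
  by rewrite -addrA -addrA [za + _]addrA zXY addrA.
exact: triangle_pow4.
Qed.

End Nilpotency.

Lemma transp4_mul01E i :
  (transp4 0 1 * transp4 2 3)%g i = nth 0%N [:: 1; 0; 3; 2]%N i :> nat.
Proof.
rewrite permM !permE /= -!val_eqE /= !inordK //.
by case: i => [[|[|[|[|]]]]] //= ?; rewrite ?inordK.
Qed.

Lemma transp4_mul02E i :
  (transp4 0 2 * transp4 1 3)%g i = nth 0%N [:: 2; 3; 0; 1]%N i :> nat.
Proof.
rewrite permM !permE /= -!val_eqE /= !inordK //.
by case: i => [[|[|[|[|]]]]] //= ?; rewrite ?inordK.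
Qed.

Section KleinAction.
Set Implicit Arguments.
Unset Strict Implicit.
Variables (k : fieldType) (B : algType k).
Hypothesis two_neq0 : 2 != 0 :> k.

Let dbl_eq0 (u : B) : u + u = 0 -> u = 0.
Proof.
move=> /eqP; rewrite -mulr2n -scaler_nat scaler_eq0 (negPf two_neq0) /=.
by move/eqP.
Qed.

Lemma eigenvector_idempotents (g h z : B) :
  1 + g + h + g * h = 0 -> z * g = g * z -> z * h = - (h * z) ->
  [/\ z * (1 + g) = 0, z * (1 + h) = (1 + g * h) * z
    & z * (1 + g * h) = (1 + h) * z].
Proof.
move=> f0 zg zh.
have zgh : z * (g * h) = - (g * h * z).
  by rewrite mulrA zg -mulrA zh mulrN mulrA.
have pE : 1 + g = - (h + g * h) by apply/eqP; rewrite -addr_eq0 addrA f0.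
have zp : z * (1 + g) = (1 + g) * z by rewrite mulrDr mulrDl zg mulr1 mul1r.
have zp0 : z * (1 + g) = 0.
  apply: dbl_eq0; rewrite {1}pE mulrN mulrDr zh zgh -opprD opprK -mulrDl zp.
  by rewrite -mulrDl [h + _ + _]addrC addrA f0 mul0r.
have pz0 : (1 + g) * z = 0 by rewrite -zp.
split=> //.
  apply/eqP; rewrite -subr_eq0 mulrDr zh mulr1 mulrDl mul1r opprD addrACA subrr.
  rewrite add0r -opprD oppr_eq0 -mulrDl.
  by rewrite -[h + _]opprK -pE mulNr pz0 oppr0.
apply/eqP; rewrite -subr_eq0 mulrDr zgh mulr1 mulrDl mul1r opprD addrACA subrr.
rewrite add0r -opprD oppr_eq0 -mulrDl addrC.
by rewrite -[h + _]opprK -pE mulNr pz0 oppr0.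
Qed.

Section Combinations.
Variables (n : nat) (x : 'I_n -> B).
Hypothesis xC : forall i j, i != j -> x i * x j + x j * x i = 0.

Definition lcomb (c : 'I_n -> k) : B := \sum_i c i *: x i.

Lemma lcomb_anticomm (c d : 'I_n -> k) :
  lcomb c * lcomb d + lcomb d * lcomb c =
    \sum_i (c i * d i) *: (x i * x i *+ 2).
Proof.
rewrite /lcomb !mulr_suml.
under eq_bigr => i _ do rewrite mulr_sumr.
under [X in _ + X]eq_bigr => i _ do rewrite mulr_sumr.
rewrite [X in _ + X]exchange_big -big_split; apply: eq_bigr => i _ /=.
rewrite -big_split (bigD1 i) //= big1 ?addr0 => [|j ji].
  by rewrite -!scalerAl -!scalerAr !scalerA [d i * _]mulrC -scalerDr -mulr2n.
rewrite -!scalerAl -!scalerAr !scalerA [d j * _]mulrC -scalerDr xC ?scaler0 //.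
by rewrite eq_sym.
Qed.

Lemma lcomb_perm (s : 'S_n) (g : B) c : (forall i, g * x i = x (s i) * g) ->
  g * lcomb (fun i => c (s i)) = lcomb c * g.
Proof.
move=> gx; rewrite /lcomb mulr_sumr mulr_suml.
rewrite [RHS](reindex_inj (@perm_inj _ s)).
by apply: eq_bigr => i _; rewrite -scalerAr gx scalerAl.
Qed.

End Combinations.

Variables (x : 'I_4 -> B) (g h : B).
Hypothesis xC : forall i j, i != j -> x i * x j + x j * x i = 0.
Hypotheses (g2 : g * g = 1) (h2 : h * h = 1) (ghC : g * h = h * g).
Hypothesis f0 : 1 + g + h + g * h = 0.
Hypothesis gx : forall i, g * x i = x ((transp4 0 1 * transp4 2 3)%g i) * g.
Hypothesis hx : forall i, h * x i = x ((transp4 0 2 * transp4 1 3)%g i) * h.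

Let sa (i : 'I_4) : k := (-1) ^+ (1 < i)%N.
Let sb (i : 'I_4) : k := (-1) ^+ odd i.
Let z c := lcomb x c.

Let char_g (u v : bool) : z (fun i => sa i ^+ u * sb i ^+ v) * g =
  (-1) ^+ v *: (g * z (fun i => sa i ^+ u * sb i ^+ v)).
Proof.
rewrite -(lcomb_perm _ gx) // scalerAr; congr (_ * _).
rewrite /z /lcomb scaler_sumr; apply: eq_bigr => i _; rewrite scalerA.
congr (_ *: _).
rewrite /sa /sb !transp4_mul01E.
by case: u; case: v; case: i => [[|[|[|[|]]]]] //= ?;
  rewrite ?(expr0, expr1, mulr1, mul1r, mulN1r, mulrN1, opprK).
Qed.

Let char_h (u v : bool) : z (fun i => sa i ^+ u * sb i ^+ v) * h =
  (-1) ^+ u *: (h * z (fun i => sa i ^+ u * sb i ^+ v)).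
Proof.
rewrite -(lcomb_perm _ hx) // scalerAr; congr (_ * _).
rewrite /z /lcomb scaler_sumr; apply: eq_bigr => i _; rewrite scalerA.
congr (_ *: _).
rewrite /sa /sb !transp4_mul02E.
by case: u; case: v; case: i => [[|[|[|[|]]]]] //= ?;
  rewrite ?(expr0, expr1, mulr1, mul1r, mulN1r, mulrN1, opprK).
Qed.

Let Z (u v : bool) := z (fun i => sa i ^+ u * sb i ^+ v).

Let Z_anticomm u v u' v' : Z u v * Z u' v' + Z u' v' * Z u v =
  \sum_i (sa i ^+ (u (+) u') * sb i ^+ (v (+) v')) *: (x i * x i *+ 2).
Proof.
have signM (b w w' : bool) :
    ((-1) ^+ b) ^+ w * ((-1) ^+ b) ^+ w' = ((-1) ^+ b) ^+ (w (+) w') :> k.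
  by case: b; case: w; case: w';
    rewrite /= ?(expr0, expr1, mulr1, mul1r, mulrNN).
rewrite lcomb_anticomm //; apply: eq_bigr => i _; congr (_ *: _).
by rewrite mulrACA /sa /sb !signM.
Qed.

Let Z_sqr u v : Z u v * Z u v = Z false false * Z false false.
Proof.
apply/eqP; rewrite -subr_eq0; apply/eqP/dbl_eq0.
by rewrite addrACA -opprD !Z_anticomm !addbb subrr.
Qed.

Let conj_pow4 (u y y' : B) :
  u * u = 1 -> u * y = y' * u -> y ^+ 4 = 0 -> y' ^+ 4 = 0.
Proof.
move=> u2 uy y0; rewrite -[LHS]mulr1 -u2 mulrA.
suff -> : forall n, y' ^+ n * u = u * y ^+ n by rewrite y0 mulr0 mul0r.
elim=> [|n IHn]; first by rewrite mulr1 mul1r.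
by rewrite exprSr -mulrA -uy mulrA IHn exprSr mulrA.
Qed.

Let gen0_pow4 : x ord0 ^+ 4 = 0.
Proof.
have f0' : 1 + h + g + h * g = 0 by rewrite -ghC [1 + h + g]addrAC.
have ghg : g * h * g = h by rewrite -mulrA -ghC mulrA g2 mul1r.
have hgh : h * (g * h) = g by rewrite ghC mulrA h2 mul1r.
have ghh : g * h * h = g by rewrite -mulrA h2 mulr1.
have ggh : g * (g * h) = h by rewrite mulrA g2 mul1r.
have f0'' : 1 + g * h + g + g * h * g = 0
  by rewrite ghg [1 + g * h + g]addrAC [LHS]addrAC.
have lg : Z false false * g = g * Z false false by rewrite char_g scale1r.
have lh : Z false false * h = h * Z false false by rewrite char_h scale1r.
have ag : Z true false * g = g * Z true false by rewrite char_g scale1r.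
have ah : Z true false * h = - (h * Z true false) by rewrite char_h scaleN1r.
have bg : Z false true * g = - (g * Z false true) by rewrite char_g scaleN1r.
have bh : Z false true * h = h * Z false true by rewrite char_h scale1r.
have cg : Z true true * g = - (g * Z true true) by rewrite char_g scaleN1r.
have ch : Z true true * h = - (h * Z true true) by rewrite char_h scaleN1r.
have cgh : Z true true * (g * h) = g * h * Z true true.
  by rewrite mulrA cg mulNr -[g * _ * h]mulrA ch mulrN opprK mulrA.
have [a1 a2 a3] := eigenvector_idempotents f0 ag ah.
have [b1 b2 b3] := eigenvector_idempotents f0' bh bg.
have [c1 c2 c3] := eigenvector_idempotents f0'' cgh cg.
rewrite -ghC in b2 b3; rewrite ghg in c2 c3.
have sE (u v : B) : (2^-1 *: u) * (2^-1 *: v) = 2^-1 *: (2^-1 *: (u * v)).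
  by rewrite -scalerAl -scalerAr.
have pq : (1 + g) * (1 + h) = 0.
  by rewrite mulrDl !mulrDr !mulr1 !mul1r addrA [1 + h + g]addrAC.
have qp : (1 + h) * (1 + g) = 0.
  by rewrite mulrDl !mulrDr !mulr1 !mul1r -ghC addrA.
have pr : (1 + g) * (1 + g * h) = 0.
  rewrite mulrDl !mulrDr !mulr1 !mul1r ggh addrA.
  by rewrite [1 + _ + g]addrAC [LHS]addrAC.
have rp : (1 + g * h) * (1 + g) = 0.
  by rewrite mulrDl !mulrDr !mulr1 !mul1r ghg addrA [LHS]addrAC.
have qr : (1 + h) * (1 + g * h) = 0.
  rewrite mulrDl !mulrDr !mulr1 !mul1r hgh [h + g]addrC addrA.
  by rewrite [1 + _ + g]addrAC [LHS]addrAC.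
have rq : (1 + g * h) * (1 + h) = 0.
  rewrite mulrDl !mulrDr !mulr1 !mul1r ghh [_ * _ + g]addrC addrA.
  by rewrite [1 + h + g]addrAC.
have pqr : (1 + g) + (1 + h) + (1 + g * h) = 2%:R.
  rewrite [X in X + _ = _]addrACA -[LHS]addrA [g + h + _]addrCA.
  by rewrite [1 + (g + h + _)]addrA [1 + (g + h)]addrA f0 addr0.
have : (Z false false + Z true false + Z false true + Z true true) ^+ 4 = 0.
  apply: (@rotation_sum_pow4 B _ _ _ _
    (2^-1 *: (1 + g)) (2^-1 *: (1 + h)) (2^-1 *: (1 + g * h))).
  - by rewrite sE pq !scaler0.
  - by rewrite sE qp !scaler0.
  - by rewrite sE pr !scaler0.
  - by rewrite sE rp !scaler0.
  - by rewrite sE qr !scaler0.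
  - by rewrite sE rq !scaler0.
  - by rewrite -!scalerDr pqr -scaler_nat scalerA mulVf ?scale1r.
  - by rewrite -scalerAr -scalerAl mulrDr mulrDl lg mulr1 mul1r.
  - by rewrite -scalerAr -scalerAl mulrDr mulrDl lh mulr1 mul1r.
  - rewrite -scalerAr -scalerAl mulrDr mulrDl mulrA lg -mulrA lh mulrA.
    by rewrite mulr1 mul1r.
  - by rewrite -scalerAr a1 scaler0.
  - by rewrite -scalerAr -scalerAl a2.
  - by rewrite -scalerAr -scalerAl a3.
  - by rewrite -scalerAr -scalerAl b2.
  - by rewrite -scalerAr b1 scaler0.
  - by rewrite -scalerAr -scalerAl b3.
  - by rewrite -scalerAr -scalerAl c2.
  - by rewrite -scalerAr -scalerAl c3.
  - by rewrite -scalerAr c1 scaler0.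
  - exact: Z_sqr.
  - exact: Z_sqr.
  - exact: Z_sqr.
  - by rewrite !Z_anticomm.
  - by rewrite !Z_anticomm.
  - by rewrite !Z_anticomm.
have -> : Z false false + Z true false + Z false true + Z true true =
    2 ^+ 2 *: x ord0.
  rewrite /Z /z /lcomb -!big_split (bigD1 ord0) //= big1 ?addr0 => [|i i0].
    rewrite /sa /sb /= !(expr0, expr1n, mulr1) -!scalerDl.
    by congr (_ *: _); rewrite -natrX -[1]/(1%:R) -!natrD.
  rewrite -!scalerDl /sa /sb; case: i i0 => [[|[|[|[|]]]]] //= ? _.
  - by rewrite ?(expr0, expr1, expr1n, mulr1, mul1r) addrK subrr scale0r.
  - by rewrite ?(expr0, expr1, expr1n, mulr1, mul1r) subrr add0r subrr scale0r.
  - rewrite ?(expr0, expr1, expr1n, mulr1, mul1r, mulrNN) subrr add0r addNr.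
    exact: scale0r.
rewrite exprZn => /eqP; rewrite scaler_eq0 !expf_eq0 /= (negPf two_neq0) /=.
by move=> /eqP.
Qed.

Lemma klein_gen_pow4 i : x i ^+ 4 = 0.
Proof.
have x1 : x (inord 1) ^+ 4 = 0.
  apply: conj_pow4 g2 _ gen0_pow4; rewrite gx; congr (x _ * _).
  by apply: ord_inj; rewrite transp4_mul01E /= inordK.
have x2 : x (inord 2) ^+ 4 = 0.
  apply: conj_pow4 h2 _ gen0_pow4; rewrite hx; congr (x _ * _).
  by apply: ord_inj; rewrite transp4_mul02E /= inordK.
have x3 : x (inord 3) ^+ 4 = 0.
  apply: conj_pow4 g2 _ x2; rewrite gx; congr (x _ * _).
  by apply: ord_inj; rewrite transp4_mul01E /= !inordK.
have := gen0_pow4.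
case: i => [[|[|[|[|]]]]] // lti4 x0; [move: x0|move: x1|move: x2|move: x3];
  by move=> <-; congr (x _ ^+ _); apply: val_inj; rewrite /= ?inordK.
Qed.

End KleinAction.

(** * The quotient of the skew group algebra *)

Section ProperIdeal.
Set Implicit Arguments.
Unset Strict Implicit.
Local Open Scope classical_set_scope.
Variables (k : fieldType) (gT : finGroupType) (A : algType k).
Variables (to : alg_action gT A) (G : {group gT}).
Local Notation sga := (skew_group_alg to G).

Lemma group_sumE z : group_sum to G z = 1.
Proof.
rewrite /group_sum sum_ffunE (bigD1 z) //= big1 => [|g gz].
  by rewrite ffunE eqxx addr0.
by rewrite ffunE eq_sym (negPf gz).
Qed.

(* An invariant augmentation maps [A # G] onto [k G], where the group sum only
   generates the constant functions. *)
Lemma group_sum_proper (eps : {rmorphism A -> k}) :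
  (forall g a, eps (to g a) = eps a) -> (G :!=: 1%g) ->
  ~ ideal_gen [set group_sum to G] 1.
Proof.
move=> eps_to Gn1.
pose J : set sga := [set u : sga | forall y z, eps (u y) = eps (u z)].
have epsM (u v : sga) z :
    eps ((u * v) z) = \sum_g eps (u g) * eps (v (z * g^-1)%g).
  rewrite [(u * v) z]sga_mulE raddf_sum; apply: eq_bigr => g _.
  by rewrite /= rmorphM /= eps_to.
have JP : two_sided_ideal J.
  split=> [y z|u v Ju Jv y z|a u Ju y z|a u Ju y z].
  - by rewrite !ffunE.
  - by rewrite !ffunE !raddfB /= (Ju y z) (Jv y z).
  - by rewrite !epsM; apply: eq_bigr => g _; rewrite (Ju _ (z * g^-1)%g).
  - have c w : eps ((u * a) w) = eps (u 1%g) * \sum_g eps (a g).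
      rewrite epsM mulr_sumr [RHS](reindex_inj (h := fun g => (w * g^-1)%g)) /=.
        by apply: eq_bigr => g _; rewrite (Ju g 1%g).
      by move=> g1 g2 /mulgI/invg_inj.
    by rewrite !c.
have Jf : [set group_sum to G] `<=` J by move=> _ -> y z; rewrite !group_sumE.
move/(ideal_gen_min JP Jf) => J1.
have /trivgPn[g Gg gn1] := Gn1.
have := J1 1%g (subg G g); rewrite ![fun_of_fin _ _]ffunE eqxx.
have -> : (subg G g == 1%g) = false.
  apply/eqP => /(congr1 sgval); rewrite subgK // => /eqP.
  by rewrite (negPf gn1).
by rewrite rmorph1 raddf0 => /eqP; rewrite oner_eq0.
Qed.

End ProperIdeal.

Section SmashEmbedding.
Set Implicit Arguments.
Unset Strict Implicit.
Local Open Scope classical_set_scope.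
Variables (k : fieldType) (gT : finGroupType) (A : algType k).
Variables (to : alg_action gT A) (G : {group gT}).
Local Notation sga := (skew_group_alg to G).

Definition smash1 (a : A) : sga := smash to a (1%g : subg_of G).

Lemma smash1_is_linear : linear smash1.
Proof.
move=> c a b; apply/ffunP => z; rewrite !ffunE.
by case: eqP => _; rewrite ?scaler0 ?addr0.
Qed.
HB.instance Definition _ := GRing.isLinear.Build k A sga _ smash1
  smash1_is_linear.

Lemma smash1_is_monoid_morphism : monoid_morphism smash1.
Proof. by split=> // a b; rewrite /smash1 smashM alg_act1 mulg1. Qed.
HB.instance Definition _ := GRing.isMonoidMorphism.Build A sga smash1
  smash1_is_monoid_morphism.

Lemma smash_split a (g : subg_of G) : smash to a g = smash1 a * smash to 1 g.
Proof. by rewrite smashM alg_act1 mulr1 mulg1. Qed.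

Lemma smash_comm a (g : subg_of G) :
  smash to 1 g * smash1 a = smash1 (to (sgval g) a) * smash to 1 g.
Proof. by rewrite -smash_split smashM mul1r mul1g. Qed.

Lemma sga_sum (u : sga) : u = \sum_g smash to (u g) g.
Proof.
apply/ffunP => z; rewrite sum_ffunE (bigD1 z) //= big1 => [|g gz].
  by rewrite ffunE eqxx addr0.
by rewrite ffunE eq_sym (negPf gz).
Qed.

End SmashEmbedding.

Section KleinGroup.
Local Open Scope group_scope.
Let s : 'S_4 := transp4 0 1 * transp4 2 3.
Let t : 'S_4 := transp4 0 2 * transp4 1 3.

Lemma transp4_mul01_sqr : s * s = 1.
Proof.
apply/permP => i; apply: ord_inj; rewrite permM perm1 !transp4_mul01E.
by case: i => [[|[|[|[|]]]]].
Qed.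

Lemma transp4_mul02_sqr : t * t = 1.
Proof.
apply/permP => i; apply: ord_inj; rewrite permM perm1 !transp4_mul02E.
by case: i => [[|[|[|[|]]]]].
Qed.

Lemma transp4_mulC : s * t = t * s.
Proof.
apply/permP => i; apply: ord_inj.
rewrite [(s * t) i]permM [(t * s) i]permM.
rewrite transp4_mul02E !transp4_mul01E transp4_mul02E.
by case: i => [[|[|[|[|]]]]].
Qed.

Lemma mem_klein4_01 : s \in klein4.
Proof. by apply: mem_gen; rewrite !inE eqxx. Qed.

Lemma mem_klein4_02 : t \in klein4.
Proof. by apply: mem_gen; rewrite !inE eqxx orbT. Qed.

Lemma klein4_elements g : g \in klein4 -> g \in [:: 1; s; t; s * t].
Proof.
have s2 := transp4_mul01_sqr; have t2 := transp4_mul02_sqr.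
have st := transp4_mulC.
have sst : s * (s * t) = t by rewrite mulgA s2 mul1g.
have tst : t * (s * t) = s by rewrite st mulgA t2 mul1g.
have sts : s * t * s = t by rewrite -mulgA -st sst.
have stt : s * t * t = s by rewrite -mulgA t2 mulg1.
have stst : s * t * (s * t) = 1 by rewrite -mulgA tst s2.
have H_group : group_set [set x in [:: 1; s; t; s * t]].
  apply/group_setP; split=> [|a b]; first by rewrite !inE eqxx.
  rewrite !inE => /or4P[] /eqP-> /or4P[] /eqP->;
    by rewrite ?(mulg1, mul1g, s2, t2, sst, tst, sts, stt, stst) -?st ?eqxx
      ?orbT.
suff /fintype.subsetP/(_ g) : klein4 \subset Group H_group by rewrite inE.
by rewrite gen_subG finset.subUset !finset.sub1set !inE !eqxx !orbT.
Qed.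

End KleinGroup.

Section KleinQuotient.
Set Implicit Arguments.
Unset Strict Implicit.
Local Open Scope classical_set_scope.
Variable k : fieldType.
Local Notation A := (skew_alg k 4).
Local Notation to := (perm_alg_action k 4).
Local Notation sga := (skew_group_alg to klein4).
Local Notation s := (subg klein4 (transp4 0 1 * transp4 2 3)%g).
Local Notation t := (subg klein4 (transp4 0 2 * transp4 1 3)%g).

Lemma sgval_s : sgval s = (transp4 0 1 * transp4 2 3)%g.
Proof. exact/subgK/mem_klein4_01. Qed.

Lemma sgval_t : sgval t = (transp4 0 2 * transp4 1 3)%g.
Proof. exact/subgK/mem_klein4_02. Qed.

Lemma klein4_neq1 : klein4 :!=: 1%g.
Proof.
apply/trivgPn; exists (transp4 0 1 * transp4 2 3)%g; first exact: mem_klein4_01.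
by apply/eqP => /permP/(_ ord0)/(congr1 val); rewrite /= transp4_mul01E perm1.
Qed.

Lemma klein4_sum (V : nmodType) (F : subg_of klein4 -> V) :
  \sum_g F g = F 1%g + F s + F t + F (s * t)%g.
Proof.
transitivity (\sum_(g <- [:: 1%g; s; t; (s * t)%g]) F g); last first.
  by rewrite !big_cons big_nil addr0 !addrA.
apply: perm_big; apply: uniq_perm; first exact: index_enum_uniq.
  pose v (g : subg_of klein4) : nat := sgval g ord0.
  apply: (@map_uniq _ _ v); rewrite /= /v.
  rewrite -[sgval (s * t)%g]/(sgval s * sgval t)%g sgval_s sgval_t.
  rewrite (permM (transp4 0 1 * transp4 2 3)%g (transp4 0 2 * transp4 1 3)%g).
  rewrite !(transp4_mul01E, transp4_mul02E) -[sgval 1%g]/(1%g : 'S_4) perm1.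
  by [].
move=> g; rewrite mem_index_enum; apply/esym.
have := klein4_elements (valP g : sgval g \in klein4).
rewrite !inE -!(inj_eq val_inj) /= sgval_s sgval_t.
by [].
Qed.

Let zero_anticomm i j : i != j :> 'I_4 -> (0 : k^o) * 0 + 0 * 0 = 0.
Proof. by move=> _; rewrite mulr0 addr0. Qed.

Definition skew_aug : A -> k^o := skew_lift (x := fun=> 0) zero_anticomm.
HB.instance Definition _ := GRing.LRMorphism.on skew_aug.

Lemma skew_aug_perm (g : 'S_4) a : skew_aug (to g a) = skew_aug a.
Proof.
pose f : {lrmorphism A -> k^o} := skew_aug \o to g.
apply: (@skew_alg_ext k 4 k^o f skew_aug) => i.
by rewrite /f /= perm_map_gen /skew_aug !skew_lift_gen.
Qed.

Lemma klein_ideal_proper : ~ ideal_gen [set group_sum to klein4] 1.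
Proof.
apply: (@group_sum_proper _ _ _ _ _ (skew_aug : {rmorphism A -> k})).
  exact: skew_aug_perm.
exact: klein4_neq1.
Qed.

Hypothesis k0 : [pchar k] =i pred0.
Hypothesis S1 : ~ ideal_gen [set group_sum to klein4] 1.
Local Notation I := (proper_ideal_gen S1).
Local Notation Q := (alg_quot I).

Definition quot_emb : A -> Q := to_quot I \o smash1 to klein4.
HB.instance Definition _ := GRing.LRMorphism.on quot_emb.

Definition quot_grp (g : subg_of klein4) : Q := to_quot I (smash to 1 g).

Lemma quot_grpM g h : quot_grp g * quot_grp h = quot_grp (h * g)%g.
Proof.
rewrite /quot_grp -[LHS](rmorphM (to_quot I)); congr to_quot.
by rewrite smashM rmorph1 mulr1.
Qed.

Lemma quot_grp_emb g a :
  quot_grp g * quot_emb a = quot_emb (to (sgval g) a) * quot_grp g.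
Proof.
rewrite /quot_grp /quot_emb /= -[LHS](rmorphM (to_quot I)).
by rewrite smash_comm [LHS](rmorphM (to_quot I)).
Qed.

Lemma quot_gen_anticomm i j : i != j ->
  quot_emb (skew_gen k i) * quot_emb (skew_gen k j) +
  quot_emb (skew_gen k j) * quot_emb (skew_gen k i) = 0.
Proof.
move=> ij; rewrite -!(rmorphM quot_emb) -(rmorphD quot_emb) skew_genP //.
exact: rmorph0.
Qed.

Lemma quot_gen_pow4 i : quot_emb (skew_gen k i) ^+ 4 = 0.
Proof.
have two_neq0 : 2 != 0 :> k by move/pcharf0P: k0 => ->.
have s2 : (s * s = 1)%g.
  by apply: val_inj; rewrite /= sgval_s transp4_mul01_sqr.
have t2 : (t * t = 1)%g.
  by apply: val_inj; rewrite /= sgval_t transp4_mul02_sqr.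
have st : (s * t = t * s)%g.
  by apply: val_inj; rewrite /= sgval_s sgval_t transp4_mulC.
have q1 : quot_grp 1%g = 1 by rewrite /quot_grp rmorph1.
apply: (@klein_gen_pow4 k Q two_neq0 (fun i => quot_emb (skew_gen k i))
  (quot_grp s) (quot_grp t)) => [|||||i1|i1].
- exact: quot_gen_anticomm.
- by rewrite quot_grpM s2.
- by rewrite quot_grpM t2.
- by rewrite !quot_grpM st.
- rewrite quot_grpM -st -q1 -klein4_sum /quot_grp -raddf_sum.
  rewrite -(raddf0 (to_quot I)); apply/to_quotP; rewrite subr0.
  exact: sub_ideal_gen.
- by rewrite quot_grp_emb sgval_s /= perm_map_gen.
- by rewrite quot_grp_emb sgval_t /= perm_map_gen.
Qed.

Lemma quot_emb_span a :
  lspan (range (fun e : {ffun 'I_4 -> 'I_4} =>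
    ordered_monomial (fun i => quot_emb (skew_gen k i)) (fun i => e i)))
  (quot_emb a).
Proof.
have [m /skew_power_sum_ordered/lspan_range[c ->]] := skew_alg_gen a.
rewrite raddf_sum; apply: lspan_sum => e _; rewrite /= linearZ; apply: lspanZ.
rewrite rmorph_prod /=.
have [/forallP e4|] := boolP [forall i, e i < 4]%N.
  apply: sub_lspan; exists [ffun i => Ordinal (e4 i)] => //.
  by congr ordered_monomial; apply/funext => i; rewrite ffunE.
rewrite negb_forall => /existsP[i]; rewrite -leqNgt => ei.
suff -> : \prod_(j <- ordered_word (fun i => e i)) quot_emb (skew_gen k j) = 0.
  exact: lspan0.
pose x i := quot_emb (skew_gen k i).
apply: (@ordered_monomial_eq0 k Q 4 x _ i 4) => //.
  exact: quot_gen_anticomm.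
by move=> w; rewrite big_cat big_nseq iter_mulr quot_gen_pow4 mul0r /= mul0r.
Qed.

Lemma quot_span (q : Q) :
  lspan (range (fun eg : {ffun 'I_4 -> 'I_4} * subg_of klein4 =>
    ordered_monomial (fun i => quot_emb (skew_gen k i)) (fun i => eg.1 i) *
      quot_grp eg.2)) q.
Proof.
rewrite -(to_quotK q) [repr q]sga_sum raddf_sum; apply: lspan_sum => g _.
set S := lspan _.
suff smash_span a : S (to_quot I (smash to a g)) by exact: smash_span.
have -> : to_quot I (smash to a g) = quot_emb a * quot_grp g.
  by rewrite smash_split (rmorphM (to_quot I)).
have /lspan_range[c ->] := quot_emb_span a.
rewrite mulr_suml; apply: lspan_sum => e _; rewrite -scalerAl; apply: lspanZ.
by apply: sub_lspan; exists (e, g).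
Qed.

End KleinQuotient.

Theorem proposition3p7 (R : realType) (k : closedFieldType)
    (k0 : [pchar k] =i pred0) :
  pertinency R (perm_alg_action k 4) klein4 = 4%:E.
Proof.
rewrite /pertinency GKdim_skew_alg // /GKdim_quot.
case: pselect => [S1|]; last by case; apply: klein_ideal_proper.
by rewrite (GKdim_fin R (quot_span k0 (S1 := S1))) sube0.
Qed.
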